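(* Consider the random intersection graph $G(n,m,F)$ defined in the context, with $m=\lfloor\beta n^\alpha\rfloor$ and $p_i=\gamma W_i n^{-(1+\alpha)/2}\wedge 1$, and assume $F$ has finite mean (normalized to $1$). Let $D_i$ be the degree of vertex $i$ in $G(n,m,F)$. Then, as $n\to\infty$: (a) if $\alpha<1$, $D_i$ converges in distribution to the point mass at $0$; (b) if $\alpha=1$, conditionally on $W_i$, $D_i$ converges in distribution to $\sum_{r=1}^{M}Y_r$, where $M\sim\mathrm{Poisson}(\beta\gamma W_i)$ and $Y_1,Y_2,\dots$ are i.i.d. $\mathrm{Poisson}(\gamma)$, all independent; that is, for every fixed value $w>0$ of $W_i$ (other weights i.i.d. $F$), the generating function satisfies $\mathbf E[t^{D_i}]\to \exp\big(\beta\gamma w(e^{\gamma(t-1)}-1)\big)$ for $t\in[0,1]$; (c) if $\alpha>1$, conditionally on $W_i$, $D_i$ converges in distribution to $\mathrm{Poisson}(\beta\gamma^2W_i)$.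
   Context: Model $G(n,m,F)$: fix constants $\alpha,\beta,\gamma>0$ and a probability distribution $F$ on $(0,\infty)$; if $F$ has finite mean it is assumed to have mean $1$. For a positive integer $n$ let $m=\lfloor\beta n^\alpha\rfloor$, let $\mathcal V=\{1,\dots,n\}$ (vertices, ''individuals'') and $\mathcal A$ a set of $m$ elements (''groups''). Let $W_1,\dots,W_n$ be i.i.d. with distribution $F$ and set $p_i=\gamma W_i n^{-(1+\alpha)/2}\wedge 1$. Conditionally on the weights, form a bipartite graph $B(n,m,F)$ on $\mathcal V\cup\mathcal A$ by including each edge between $i\in\mathcal V$ and $a\in\mathcal A$ independently with probability $p_i$. The graph $G(n,m,F)$ on $\mathcal V$ has an edge between distinct $i,j$ iff some $a\in\mathcal A$ is adjacent to both $i$ and $j$ in $B(n,m,F)$. The parameters $\alpha,\beta,\gamma,F$ do not depend on $n$. *)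

(* Defs.v *)
From HB Require Import structures.
From mathcomp Require Import all_boot all_order all_algebra.
From mathcomp Require Import all_classical all_reals all_analysis.
Set Implicit Arguments. Unset Strict Implicit. Unset Printing Implicit Defensive.
Import Order.TTheory GRing.Theory Num.Def Num.Theory.
Import numFieldNormedType.Exports.
Local Open Scope classical_set_scope.
Local Open Scope ring_scope.

Section GnmF.
Context {R : realType}.

Definition ngroups (alpha beta : R) (n : nat) : nat :=
  Num.truncn (beta * (n%:R `^ alpha)).

Definition pedge (alpha gamma : R) (n : nat) (w : R) : R :=
  Num.min (gamma * w * (n%:R `^ (- (1 + alpha) / 2))) 1.

Definition mutually_indep d (T : measurableType d) (P : probability T R)
  (I : finType) (X : I -> T -> R) : Prop :=
  forall B : I -> set R, (forall k, measurable (B k)) ->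
    P (\bigcap_k (X k @^-1` B k)) = (\prod_(k : I) fine (P (X k @^-1` B k)))%:E.

(* Vertex j (< n) and group a (< m) are adjacent in B(n,m,F) iff U j a < p_j,
   where the U j a are i.i.d. uniform on [0,1], independent of the weights. *)
Definition edge (alpha gamma : R) (n : nat) d (T : measurableType d)
  (W : nat -> T -> R) (U : nat -> nat -> T -> R) (j a : nat) (x : T) : bool :=
  U j a x < pedge alpha gamma n (W j x).

Definition degree (alpha beta gamma : R) (n i : nat) d (T : measurableType d)
  (W : nat -> T -> R) (U : nat -> nat -> T -> R) (x : T) : nat :=
  #|[set j : 'I_n | ((j : nat) != i) &&
      [exists a : 'I_(ngroups alpha beta n),
         edge alpha gamma n W U i a x && edge alpha gamma n W U j a x]]|.

(* (T,P,W,U) realizes the model G(n,m,F) (vertices 0..n-1, groups 0..m-1).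
   If wi = None, all weights W_0..W_{n-1} are i.i.d. with law F;
   if wi = Some w, the weight of vertex i is the constant w and the other
   weights are i.i.d. with law F (i.e. we condition on W_i = w). *)
Definition GnmF_model (alpha beta gamma : R) (F : probability R R) (n i : nat)
  (wi : option R) d (T : measurableType d) (P : probability T R)
  (W : nat -> T -> R) (U : nat -> nat -> T -> R) : Prop :=
  let m := ngroups alpha beta n in
  [/\ (forall j, measurable_fun setT (W j)) /\
      (forall j a, measurable_fun setT (U j a)),
      forall j : 'I_n,
        match wi with Some w => (j : nat) = i -> W j = (fun=> w) | None => True end,
      forall j : 'I_n,
        match wi with Some _ => (j : nat) <> i | None => True end ->
        forall A, measurable A -> P (W j @^-1` A) = F A,
      forall (j : 'I_n) (a : 'I_m) A, measurable A ->
        P (U j a @^-1` A) = uniform_prob (@ltr01 R) A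
    & mutually_indep P (fun k : 'I_n + ('I_n * 'I_m) =>
        match k with inl j => W j | inr ja => U ja.1 ja.2 end)].

(* convergence in distribution of nat-valued random variables D n (each on its
   own probability space) to a probability law mu on nat (discrete topology:
   every bounded function is continuous). *)
Definition cvg_dist_nat d (T : nat -> measurableType d)
  (P : forall n, probability (T n) R) (D : forall n, T n -> nat)
  (mu : probability nat R) : Prop :=
  forall f : nat -> R, (exists M : R, forall k, `|f k| <= M) ->
    (fun n => (\int[P n]_x (f (D n x))%:E)%E) @ \oo --> (\int[mu]_k (f k)%:E)%E.

End GnmF.

(* Main.v *)
(* Independence gives the exact generating function: conditionally on the set S
   of groups of vertex i, the other vertices are adjacent to i independently,
   each with probability 1 - E[(1 - p(W))^|S|], so that
     E[t^D] = E[(1 - (1 - t)(1 - E[(1 - p(W))^K]))^(n - 1)],  K ~ Bin(m, p(w)).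
   With mu = E[p(W)] one replaces 1 - E[(1 - p(W))^K] by K mu; since only the
   first moment of W is available, the second-order term of p(W) is truncated at
   W <= A, and the total error is controlled by n m p^2 -> beta gamma^2 and by
   E[W; W > A]. What remains is (1 - p(w) (1 - (1 - (1 - t) mu)^(n - 1)))^m,
   whose limit is elementary. For alpha > 1 convergence in distribution follows
   from convergence of generating functions; for alpha < 1 vertex i belongs to
   no group with probability tending to 1. *)

Require Import Defs.
From HB Require Import structures.
From mathcomp Require Import all_boot all_order all_algebra.
From mathcomp Require Import all_classical all_reals all_analysis.
From mathcomp Require Import measurable_realfun ring lra.
Import Order.TTheory GRing.Theory Num.Def Num.Theory.
Import numFieldNormedType.Exports.
Local Open Scope classical_set_scope.
Local Open Scope ring_scope.

Set Implicit Arguments.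
Unset Strict Implicit.
Unset Printing Implicit Defensive.

(** * Joint laws of weights and uniform variables *)

(** The independence hypothesis speaks only of events in single variables, whereas an edge compares
    [U j a] with a function of [W j]. The law of the bipartite graph is therefore obtained by
    trading these comparisons one at a time for section probabilities, each time identifying a
    measure from its values on rectangles. All expectations then become finite sums over
    configurations (one set of groups per vertex); conditional expectations never appear, and fixing
    W_i = w amounts to a Dirac law for that weight. Write pi for [edge_scale], so that p(w) = min(w
    pi, 1). Since E[K] <= m w pi and n m pi^2 stays bounded, the second-order error, once multiplied
    by n, is of order (A + 1)(pi + 1/n) and vanishes for fixed A, while the tail error is of order
    E[W; W > A] uniformly in n. Hence A is chosen before n. For alpha > 1 the passage from
    generating functions to laws recovers the indicator of each integer, by induction, as a uniform
    limit of combinations of the sequences t^k. *)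

Section density_measure.
Local Open Scope ereal_scope.
Context {d} {T : measurableType d} {R : realType}.
Variables (mu : {measure set T -> \bar R}) (f : T -> \bar R).

(** The two proofs are arguments of the definition so that the measure structure, which depends on
    them, can be attached to it. *)
Definition density_measure of measurable_fun setT f & (forall x, 0 <= f x) :=
  fun A : set T => \int[mu]_(x in A) f x.

Hypotheses (mf : measurable_fun setT f) (f0 : forall x, 0 <= f x).
Let nu := density_measure mf f0.

Let nu0 : nu set0 = 0. Proof. exact: integral_set0. Qed.

Let nu_ge0 A : 0 <= nu A. Proof. exact: integral_ge0. Qed.

Let nu_sigma_additive : semi_sigma_additive nu.
Proof.
move=> F mF tF mUF; apply: cvg_toP.
  apply: ereal_nondecreasing_is_cvgn => a b ab.
  by apply: lee_sum_nneg_natr => // k _ _; exact: nu_ge0.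
by rewrite /nu /density_measure ge0_integral_bigcup//; exact: measurable_funTS.
Qed.

HB.instance Definition _ := isMeasure.Build _ _ _ (density_measure mf f0)
  nu0 nu_ge0 nu_sigma_additive.

End density_measure.

Section product_with_density.
Local Open Scope ereal_scope.
Context {d1 d2} {T1 : measurableType d1} {T2 : measurableType d2} {R : realType}.
Variables (mu : probability T1 R) (la : probability T2 R) (h : T1 -> \bar R).
Hypotheses (mh : measurable_fun setT h) (h0 : forall x, 0 <= h x).

Let mh1 : measurable_fun [set: T1 * T2] (h \o fst).
Proof. exact: measurableT_comp. Qed.

Let h10 (z : T1 * T2) : 0 <= (h \o fst) z.
Proof. exact: h0. Qed.

Let integral_section (S : set (T1 * T2)) : measurable S ->
  density_measure (mu \x la) mh1 h10 S =
  \int[mu]_x (h x * la (xsection S x)).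
Proof.
move=> mS; rewrite /density_measure integral_mkcond fubini_tonelli1//; last 2 first.
- by apply/(measurable_restrictT _ mS)/measurable_funTS.
- by move=> z; rewrite patchE; case: ifP.
apply: eq_integral => x _; rewrite /fubini_F.
rewrite (eq_integral (fun y => h x * (\1_(xsection S x) y)%:E)); last first.
  move=> y _; rewrite patchE indicE mem_xsection.
  by case: ifP => _; rewrite ?mule1 ?mule0.
rewrite ge0_integralZl// ?integral_indic ?setIT//; first exact: measurable_xsection.
by apply/measurable_EFinP/measurable_indic; exact: measurable_xsection.
Qed.

(** Rectangles form a pi-system generating the product sigma-algebra, and [N] agrees on them with
    the product measure weighted by the density h(x); finite mass allows the uniqueness theorem. In
    the application [N] is the joint law of one weight and one uniform variable on an event that
    also depends on the weight, and [h] records that dependence. *)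
Lemma product_with_density_unique (N : {measure set (T1 * T2) -> \bar R}) :
  N setT < +oo ->
  (forall A C, measurable A -> measurable C ->
     N (A `*` C) = (\int[mu]_(x in A) h x) * la C) ->
  forall S, measurable S -> N S = \int[mu]_x (h x * la (xsection S x)).
Proof.
move=> Noo NE S mS; rewrite -integral_section//.
pose C : set (set (T1 * T2)) :=
  [set C | exists2 A, measurable A & exists2 B, measurable B & A `*` B = C].
apply: (measure_unique C (fun=> setT)) => //.
- rewrite measurable_prod_measurableType//; congr (<<s _ >>).
- move=> _ _ [A mA [B mB <-]] [A' mA' [B' mB' <-]].
  rewrite -setXI; exists (A `&` A'); first exact: measurableI.
  by exists (B `&` B') => //; exact: measurableI.
- by move=> _; exists setT => //; exists setT => //; rewrite setXTT.
- by rewrite bigcup_const//; exists 0%N.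
move=> _ [A mA [B mB <-]]; rewrite NE// [RHS]integral_section; last exact: measurableX.
rewrite [RHS](eq_integral (fun x => (h \_ A) x * la B)); last first.
  move=> x _; rewrite patchE; case: ifPn => xA; first by rewrite in_xsectionX.
  by rewrite notin_xsectionX// measure0 mule0 mul0e.
rewrite [RHS]ge0_integralZr//.
- by rewrite -integral_mkcond.
- by apply/(measurable_restrictT _ mA)/measurable_funTS.
- by move=> x _; rewrite patchE; case: ifP.
Qed.

End product_with_density.

(** * From independence on rectangles to events coupling weights and uniform variables *)

Section section_probabilities.
Context {d d1 d2} {T : measurableType d} {T1 : measurableType d1}
  {T2 : measurableType d2} {R : realType} (P : probability T R).
Context (I J : finType) (v : I -> J).
Variables (W : J -> T -> T1) (U : I -> T -> T2).
Variables (F : J -> probability T1 R) (la : probability T2 R).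
Variable G : I -> set (T1 * T2).

Hypothesis mW : forall j, measurable_fun setT (W j).
Hypothesis mU : forall k, measurable_fun setT (U k).
Hypothesis mG : forall k, measurable (G k).

Definition section_prob (k : I) (x : T1) : R := fine (la (xsection (G k) x)).

(** Conditional probability, given W_j = x, that all events of [Q] attached to j occur; [v k] is the
    index of the weight entering the event [G k]. *)
Definition section_weight (Q : {set I}) (j : J) (x : T1) : R :=
  \prod_(k in Q | v k == j) section_prob k x.

(** Interpolates between a rectangle ([Q] empty), whose probability is given by independence, and
    the joint event of all the [G k] ([Q] full). The sets [C k] test those uniform variables that
    are not yet coupled to a weight. *)
Definition section_event (Q : {set I}) (B : J -> set T1) (C : I -> set T2) :
    set T :=
  [set x | (forall j, B j (W j x)) /\
    forall k, if k \in Q then G k (W (v k) x, U k x) else C k (U k x)].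

Let measurable_coordinates (j : J) (k : I) :
  measurable_fun setT (fun x => (W j x, U k x)).
Proof. exact: measurable_fun_pair. Qed.

Lemma section_prob_itv k x : 0 <= section_prob k x <= 1.
Proof.
rewrite /section_prob fine_ge0//= -lee_fin fineK ?fin_num_measure//.
  by apply: probability_le1; exact: measurable_xsection.
exact: measurable_xsection.
Qed.

Lemma measurable_section_prob k : measurable_fun setT (section_prob k).
Proof.
apply/measurable_EFinP; apply: (eq_measurable_fun (la \o xsection (G k))).
  by move=> x _ /=; rewrite fineK// fin_num_measure//; exact: measurable_xsection.
exact: measurable_fun_xsection.
Qed.

Lemma section_weight_itv Q j x : 0 <= section_weight Q j x <= 1.
Proof.
rewrite /section_weight prodr_ge0 => [|k _]; last by case/andP: (section_prob_itv k x).
by rewrite prodr_ile1// => k _; exact: section_prob_itv.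
Qed.

Lemma measurable_section_weight Q j : measurable_fun setT (section_weight Q j).
Proof.
rewrite /section_weight; under eq_fun do rewrite -big_filter.
by apply: measurable_prod => k _; exact: measurable_section_prob.
Qed.

Lemma measurable_section_event Q B C :
  (forall j, measurable (B j)) -> (forall k, measurable (C k)) ->
  measurable (section_event Q B C).
Proof.
move=> mB mC.
rewrite (_ : section_event _ _ _ = (\bigcap_j (W j @^-1` B j)) `&`
  (\bigcap_k (if k \in Q then (fun x => (W (v k) x, U k x)) @^-1` G k
              else U k @^-1` C k))); last first.
  apply/seteqP; split=> [x [h1 h2]|x [h1 h2]].
    by split=> [j _|k _]; [exact: h1|have := h2 k; case: ifP].
  by split=> [j|k]; [exact: h1|have := h2 k Logic.I; case: ifP].
apply: measurableI; apply: fin_bigcap_measurable => //.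
  by move=> j _; rewrite -[X in measurable X]setTI; exact: mW.
move=> k _; case: ifP => _; rewrite -[X in measurable X]setTI.
  exact: measurable_coordinates.
exact: mU.
Qed.

Let integrable_section_weight Q j (B : set T1) : measurable B ->
  (F j).-integrable B (EFin \o section_weight Q j).
Proof.
move=> mB; apply: measurable_bounded_integrable => //.
- by rewrite ltey_eq (fin_num_measure (F j)).
- by apply: measurable_funTS; exact: measurable_section_weight.
- exists 1; split => // M M1 x _ /=; have /andP[? ?] := section_weight_itv Q j x.
  by rewrite ger0_norm// (le_trans _ (ltW M1)).
Qed.

Hypothesis indep : forall B C,
  (forall j, measurable (B j)) -> (forall k, measurable (C k)) ->
  P (section_event finset.set0 B C) =
  ((\prod_j fine (F j (B j))) * \prod_k fine (la (C k)))%:E.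

(** Induction on the size of [Q]. One coupled index k0 is removed and the remaining event kept as a
    restriction of [P]; the induction hypothesis gives the law of (W_j0, U_k0) there on rectangles,
    uniqueness extends it to [G k0], and integrating out U_k0 supplies the missing factor of
    [section_weight]. *)
Lemma section_event_prob Q B C :
  (forall j, measurable (B j)) -> (forall k, measurable (C k)) ->
  P (section_event Q B C) =
  ((\prod_j \int[F j]_(x in B j) section_weight Q j x) *
   \prod_(k | k \notin Q) fine (la (C k)))%:E.
Proof.
move: {2}#|Q| (erefl #|Q|) => n; elim: n Q B C => [|n IH] Q B C cQ mB mC.
  have -> : Q = finset.set0 by apply/eqP; rewrite -cards_eq0 cQ.
  rewrite indep//; congr (_ * _)%:E; last by apply: eq_bigl => k; rewrite inE.
  apply: eq_bigr => j _; rewrite /Rintegral (eq_integral (cst 1%E)); last first.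
    move=> x _; rewrite /section_weight big_pred0// => k; by rewrite inE.
  by rewrite integral_cst// mul1e.
have /card_gt0P[k0 k0Q] : (0 < #|Q|)%N by rewrite cQ.
pose Q' := (Q :\ k0)%SET; pose j0 := v k0.
have cQ' : #|Q'| = n by move: cQ; rewrite (cardsD1 k0) k0Q => -[].
have k0Q' : k0 \notin Q' by rewrite !inE eqxx.
(* U_k0 is left unconstrained, so that it can be tested afterwards jointly with W_j0. *)
pose CT := fun k => if k == k0 then setT else C k.
have mCT k : measurable (CT k) by rewrite /CT; case: ifP.
have mE : measurable (section_event Q' B CT) by exact: measurable_section_event.
pose E := section_event Q' B CT.
(* Law of (W_j0, U_k0) on the event where all the other constraints hold. *)
pose N : {measure set (T1 * T2) -> \bar R} :=
  measure_function_pushforward__canonical__measure_function_Measure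
    [the measure _ _ of mrestr P mE] (measurable_coordinates j0 k0).
have NE S : N S = P ([set x | S (W j0 x, U k0 x)] `&` E) by [].
(* Constant part of the density: the factors of the weights other than W_j0 and of the uniform
   variables outside [Q]. For j != j0 the sets [Q] and [Q'] give the same section weight. *)
pose K := (\prod_(j | j != j0) \int[F j]_(x in B j) section_weight Q' j x) *
   \prod_(k | k \notin Q) fine (la (C k)).
have K0 : 0 <= K.
  apply: mulr_ge0; apply: prodr_ge0 => i _; last exact: fine_ge0.
  by apply: Rintegral_ge0 => x _; case/andP: (section_weight_itv Q' i x).
pose h := fun x => (K%:E * ((EFin \o section_weight Q' j0) \_ (B j0)) x)%E.
have mw : measurable_fun setT ((EFin \o section_weight Q' j0) \_ (B j0)).
  apply/(measurable_restrictT _ (mB j0))/measurable_funTS/measurable_EFinP.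
  exact: measurable_section_weight.
have w0 x : (0 <= ((EFin \o section_weight Q' j0) \_ (B j0)) x)%E.
  rewrite patchE; case: ifP => // _; rewrite lee_fin.
  by case/andP: (section_weight_itv Q' j0 x).
have mh : measurable_fun setT h by exact: measurable_funeM.
have h0 x : (0 <= h x)%E by rewrite mule_ge0// lee_fin.
have Noo : (N setT < +oo)%E.
  by rewrite NE ltey_eq fin_num_measure//; apply: measurableI => //; exact: measurableT.
have -> : P (section_event Q B C) = N (G k0).
  rewrite NE; congr (P _); apply/seteqP; split=> x.
    move=> [h1 h2]; split; first by have := h2 k0; rewrite k0Q.
    split=> // k; have := h2 k; rewrite !inE /CT.
    by case: eqVneq => //= _.
  move=> [Gx [h1 h2]]; split=> // k; have := h2 k; rewrite !inE /CT.
  by case: eqVneq => [->|//]; rewrite k0Q.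
rewrite (product_with_density_unique (mu := F j0) (la := la) mh h0)//; last first.
  move=> A D mA mD; rewrite NE.
  pose BA := fun j => if j == j0 then A `&` B j0 else B j.
  pose CD := fun k => if k == k0 then D else C k.
  have -> : [set x | (A `*` D) (W j0 x, U k0 x)] `&` E = section_event Q' BA CD.
    apply/seteqP; split=> x.
      move=> [[/= xA xD] [h1 h2]]; split=> [j|k].
        by rewrite /BA; case: eqVneq => [->|]//; split=> //; exact: h1.
      have := h2 k; rewrite /CT /CD; case: (eqVneq k k0) => [->|//].
      by rewrite (negbTE k0Q').
    move=> [h1 h2]; split; first split=> /=.
    - by have := h1 j0; rewrite /BA eqxx => -[].
    - by have := h2 k0; rewrite (negbTE k0Q') /CD eqxx.
    split=> [j|k].
      by have := h1 j; rewrite /BA; case: eqVneq => [-> []|].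
    have := h2 k; rewrite /CT /CD; case: (eqVneq k k0) => [->|//].
    by rewrite (negbTE k0Q').
  rewrite IH//; last 2 first.
  - by move=> j; rewrite /BA; case: ifP => // _; exact: measurableI.
  - by move=> k; rewrite /CD; case: ifP.
  rewrite (bigD1 j0)//= [in RHS]ge0_integralZl//; last exact: measurable_funTS.
  rewrite -[in RHS]integral_mkcondr.
  have fI : (\int[F j0]_(x in A `&` B j0) (section_weight Q' j0 x)%:E)%E \is a fin_num.
    apply: integrable_fin_num; first exact: measurableI.
    by apply: integrable_section_weight; exact: measurableI.
  rewrite -[X in (_ * X * _)%E](fineK fI) -[X in (_ * X)%E](@fineK _ (la D)) ?fin_num_measure//.
  rewrite -!EFinM; congr EFin.
  rewrite (bigD1 k0)//= {1}/BA {1}/CD !eqxx.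
  rewrite (eq_bigr (fun j => \int[F j]_(x in B j) section_weight Q' j x)); last first.
    by move=> j /negbTE jj0; rewrite /BA jj0.
  rewrite [X in _ * (_ * X) = _](_ : _ = \prod_(k | k \notin Q) fine (la (C k))).
    by rewrite /K /Rintegral; ring.
  apply: eq_big => k; rewrite !inE; first by case: eqVneq => [->|]; rewrite ?k0Q ?andbT.
  by case/andP => _ /negbTE kk0; rewrite /CD kk0.
rewrite (eq_integral (fun x => K%:E * ((EFin \o section_weight Q j0) \_ (B j0)) x)%E); last first.
  move=> x _; rewrite /h -muleA; congr (_ * _)%E.
  rewrite !patchE; case: ifP => _; last by rewrite mul0e.
  rewrite /= -[X in (_ * X)%E]fineK; last by rewrite fin_num_measure//; exact: measurable_xsection.
  rewrite -EFinM; congr EFin.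
  rewrite [in RHS]/section_weight (bigD1 k0)/=; last by rewrite k0Q eqxx.
  rewrite mulrC; congr (_ * _); apply: eq_bigl => k; rewrite !inE.
  by rewrite -andbA andbC.
have fI : (\int[F j0]_(x in B j0) (section_weight Q j0 x)%:E)%E \is a fin_num.
  by apply: integrable_fin_num => //; exact: integrable_section_weight.
rewrite ge0_integralZl//; last 2 first.
- apply/(measurable_restrictT _ (mB j0))/measurable_funTS/measurable_EFinP.
  exact: measurable_section_weight.
- move=> x _; rewrite patchE; case: ifP => // _; rewrite lee_fin.
  by case/andP: (section_weight_itv Q j0 x).
rewrite -integral_mkcond -[X in (_ * X)%E](fineK fI) -EFinM; congr EFin.
rewrite (bigD1 j0)//= /K.
rewrite [in RHS](eq_bigr (fun j => \int[F j]_(x in B j) section_weight Q' j x)); last first.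
  move=> j jj0; apply: eq_Rintegral => x _; apply: eq_bigl => k; rewrite !inE.
  by case: (eqVneq k k0) => [->|//]; rewrite eq_sym (negbTE jj0) andbF.
by rewrite /Rintegral; ring.
Qed.

End section_probabilities.

(** * Binomial random subsets *)

Section binomial_subsets.
Context {R : realType} (m : nat).
Implicit Types (r c : R) (S Z : {set 'I_m}).

(** Probability that a random set of groups, each taken independently with probability r, equals
    S. *)
Definition subset_weight r S : R := \prod_a (if a \in S then r else 1 - r).

Lemma subset_weight_ge0 r S : 0 <= r <= 1 -> 0 <= subset_weight r S.
Proof.
by move=> /andP[r0 r1]; apply: prodr_ge0 => a _; case: ifP; rewrite ?subr_ge0.
Qed.

(** Expanding the product on the right group by group gives the sum over subsets: independence of
    the groups. Suitable [x] and [y] yield the size generating function, the disjointness and the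
    inclusion probabilities. *)
Lemma sum_subset_weight_prod r (x y : 'I_m -> R) :
  \sum_S subset_weight r S * \prod_a (if a \in S then x a else y a) =
  \prod_a (r * x a + (1 - r) * y a).
Proof.
rewrite bigA_distr/=; apply: eq_bigr => S _.
by rewrite -big_split/=; apply: eq_bigr => a _; case: ifP.
Qed.

Lemma sum_subset_weight r : \sum_S subset_weight r S = 1.
Proof.
transitivity (\prod_(a < m) (r + (1 - r))); first by rewrite bigA_distr.
by rewrite big1// => a _; rewrite addrC subrK.
Qed.

Lemma sum_subset_weight_expr r c :
  \sum_S subset_weight r S * c ^+ #|S| = (1 - r + r * c) ^+ m.
Proof.
transitivity (\prod_(a < m) (r * c + (1 - r) * 1)).
  rewrite -(sum_subset_weight_prod r (fun=> c) (fun=> 1)).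
  apply: eq_bigr => S _; congr (_ * _).
  by rewrite -big_mkcond/= prodr_const.
by rewrite prodr_const card_ord mulr1 addrC.
Qed.

Lemma sum_subset_weight_disjoint r Z :
  \sum_(S : {set 'I_m} | [disjoint S & Z]) subset_weight r S = (1 - r) ^+ #|Z|.
Proof.
rewrite big_mkcond/=.
transitivity (\prod_a (r * (a \notin Z)%:R + (1 - r) * 1)).
  rewrite -(sum_subset_weight_prod r (fun a => (a \notin Z)%:R) (fun=> 1)).
  apply: eq_bigr => S _; rewrite -big_mkcond/=; case: ifPn => [dSZ|].
    rewrite big1 ?mulr1// => a aS.
    by rewrite (disjointFr dSZ aS).
  rewrite disjoint_subset => /subsetPn[a aS]; rewrite inE negbK => aZ.
  by rewrite (bigD1 a)//= aZ mul0r mulr0.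
rewrite -prodr_const [RHS]big_mkcond/=; apply: eq_bigr => a _.
by case: (a \in Z); rewrite ?mulr0 ?add0r mulr1// mulr1 addrC subrK.
Qed.

Let sum_subset_weight_mem r Z :
  \sum_S subset_weight r S * (Z \subset S)%:R = r ^+ #|Z|.
Proof.
transitivity (\prod_a (r * 1 + (1 - r) * (a \notin Z)%:R)).
  rewrite -(sum_subset_weight_prod r (fun=> 1) (fun a => (a \notin Z)%:R)).
  apply: eq_bigr => S _; congr (_ * _).
  have [ZS|/subsetPn[a aZ aS]] := boolP (Z \subset S).
    rewrite big1// => a _; case: ifPn => // aS.
    by rewrite (contra (fintype.subsetP ZS a)).
  by rewrite (bigD1 a)//= (negbTE aS) aZ mul0r.
rewrite -prodr_const [RHS]big_mkcond/=; apply: eq_bigr => a _.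
by case: (a \in Z); rewrite mulr1 ?mulr0 ?addr0// mulr1 addrC subrK.
Qed.

Lemma sum_subset_weight_card r : \sum_S subset_weight r S * #|S|%:R = m%:R * r.
Proof.
transitivity (\sum_S \sum_a subset_weight r S * ([set a]%SET \subset S)%:R).
  apply: eq_bigr => S _; rewrite -mulr_sumr -natr_sum; congr (_ * _%:R).
  by rewrite -sum1_card big_mkcond/=; apply: eq_bigr => a _; rewrite finset.sub1set; case: (a \in S).
rewrite exchange_big/=.
under eq_bigr do rewrite sum_subset_weight_mem cards1 expr1.
by rewrite sumr_const card_ord mulr_natl.
Qed.

(** The squared size counts ordered pairs (a, b) of chosen groups: a pair has probability r on the
    diagonal and r^2 off it. The bound adds the diagonal terms r^2 to complete the square (m
    r)^2. *)
Lemma sum_subset_weight_card2 r : 0 <= r ->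
  \sum_S subset_weight r S * #|S|%:R ^+ 2 <= m%:R * r + (m%:R * r) ^+ 2.
Proof.
move=> r0.
have -> : \sum_S subset_weight r S * #|S|%:R ^+ 2 =
    \sum_a \sum_b \sum_S subset_weight r S * ([set a; b]%SET \subset S)%:R.
  under [RHS]eq_bigr do rewrite exchange_big/=.
  rewrite [RHS]exchange_big/=; apply: eq_bigr => S _.
  rewrite expr2 -[X in _ * (X%:R * _) = _]sum1_card natr_sum mulr_suml mulr_sumr.
  rewrite big_mkcond/=; apply: eq_bigr => a _; rewrite -mulr_sumr -natr_sum.
  case: (boolP (a \in S)) => aS; last first.
    by rewrite big1 ?mulr0// => b _; rewrite finset.subUset finset.sub1set (negbTE aS).
  rewrite mul1r -sum1_card big_mkcond/=; congr (_ * _%:R); apply: eq_bigr => b _.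
  by rewrite finset.subUset !finset.sub1set aS; case: (b \in S).
rewrite (le_trans (y := \sum_(a < m) (r + m%:R * r ^+ 2)))//; last first.
  by rewrite sumr_const card_ord -[_ *+ m]mulr_natl mulrDr exprMn expr2 mulrA.
apply: ler_sum => a _; rewrite (bigD1 a)//= sum_subset_weight_mem finset.setUid cards1.
rewrite expr1 lerD2l (le_trans (y := \sum_(b < m) r ^+ 2))//; last first.
  by rewrite sumr_const card_ord mulr_natl.
rewrite [leRHS](bigD1 a)//= -[leLHS]add0r lerD ?sqr_ge0//.
by apply: ler_sum => b ba; rewrite sum_subset_weight_mem cards2 eq_sym ba.
Qed.

End binomial_subsets.

(** * The configuration of groups and the law of the degree *)

Lemma measurable_pedge {R : realType} (alpha gamma : R) n :
  measurable_fun setT (pedge alpha gamma n).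
Proof.
by apply: measurable_minr => //; apply: measurable_funM => //.
Qed.

Section edge_probability.
Context {R : realType} (alpha gamma : R) (n : nat).

(* Equal to [pedge] where the latter is nonnegative, and to [0] for the
   ([F]-negligible) negative weights. *)
Definition edge_prob (x : R) : R :=
  fine (uniform_prob (@ltr01 R) [set u | u < pedge alpha gamma n x]).

Let measurable_lt (c : R) : measurable [set u : R | u < c].
Proof.
by rewrite (_ : [set _ | _] = `]-oo, c[%classic)//.
Qed.

Lemma edge_prob_itv x : 0 <= edge_prob x <= 1.
Proof.
rewrite /edge_prob fine_ge0//= -lee_fin fineK; last first.
  by apply: fin_num_measure; exact: measurable_lt.
by apply: probability_le1; exact: measurable_lt.
Qed.

Lemma uniform_prob_pedge x (b : bool) :
  fine (uniform_prob (@ltr01 R) [set u | (u < pedge alpha gamma n x) = b]) =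
  if b then edge_prob x else 1 - edge_prob x.
Proof.
case: b => //; rewrite (_ : [set _ | _] = ~` [set u | u < pedge alpha gamma n x]).
  rewrite probability_setC; last exact: measurable_lt.
  by rewrite fineB//; apply: fin_num_measure; exact: measurable_lt.
by apply/seteqP; split=> u /= => [->|/negP/negbTE].
Qed.

Lemma measurable_edge_event (b : bool) :
  measurable [set z : R * measurableTypeR R | (z.2 < pedge alpha gamma n z.1) = b].
Proof.
have /(_ measurableT [set b]) := @measurable_fun_ltr _ (R * measurableTypeR R)%type R setT
  snd (pedge alpha gamma n \o fst) measurable_snd
  (measurableT_comp (measurable_pedge alpha gamma n) measurable_fst).
by rewrite setTI; exact.
Qed.

Lemma measurable_edge_prob : measurable_fun setT edge_prob.
Proof.
(* The edge probability is a section probability for a one-element family of events. *)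
have := measurable_section_prob (uniform_prob (@ltr01 R))
  (fun _ : unit => measurable_edge_event true) tt.
apply: eq_measurable_fun => x _; rewrite /section_prob /edge_prob.
by congr (fine (_ _)); apply/seteqP; split=> u; rewrite /xsection/= inE.
Qed.

Lemma edge_probE x : 0 <= pedge alpha gamma n x ->
  edge_prob x = pedge alpha gamma n x.
Proof.
set c := pedge _ _ _ _ => c0; have c1 : c <= 1 by rewrite ge_min lexx orbT.
rewrite /edge_prob /uniform_prob integral_uniform_pdf.
rewrite (eq_integral (cst 1%E)); last first.
  move=> u; rewrite inE/= => -[_]; rewrite in_itv/= /uniform_pdf => ->.
  by rewrite subr0 invr1.
rewrite integral_cst//=; last first.
  by apply: measurableI => //; exact: measurable_lt.
rewrite mul1e (_ : _ `&` _ = `[0, c[%classic).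
  by rewrite lebesgue_measure_itv/= lte_fin; case: ltP => [_|c00]; [rewrite sube0|have -> : c = 0 by apply/le_anti/andP].
apply/seteqP; split=> u /=; rewrite !in_itv/=; first by move=> [-> /andP[->]].
by move=> /andP[-> uc]; rewrite uc (le_trans (ltW uc)).
Qed.

End edge_probability.

(** * Law of the bipartite configuration *)

Section configurations.
Context {R : realType} (alpha beta gamma : R) (F : probability R R).
Context (n : nat) (i : 'I_n) (wi : option R).
Context {d} {T : measurableType d} (P : probability T R).
Variables (W : nat -> T -> R) (U : nat -> nat -> T -> R).

Hypothesis model : GnmF_model alpha beta gamma F n i wi P W U.

Let m := ngroups alpha beta n.
Let p := pedge alpha gamma n.

(** A constant weight is a weight with Dirac law, so the unconditioned and the conditioned model
    share one product formula. *)
Definition weight_law (j : 'I_n) : probability R R :=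
  if wi is Some w then if j == i then [the probability R R of \d_w] else F
  else F.

(** Finite summary of the bipartite graph that determines the degree; its finitely many values turn
    expectations into finite sums. *)
Definition edge_config (x : T) : {ffun 'I_n -> {set 'I_m}} :=
  [ffun j : 'I_n => finset (fun a : 'I_m => edge alpha gamma n W U j a x)].

Definition config_degree (e : {ffun 'I_n -> {set 'I_m}}) : nat :=
  #|finset (fun j : 'I_n => (j != i) && ~~ [disjoint e j & e i])|.

Lemma degree_edge_config x :
  degree alpha beta gamma n i W U x = config_degree (edge_config x).
Proof.
apply: eq_card => j; rewrite [RHS]finset.in_set.
apply/idP/andP => [/set_mem/= /andP[-> /existsP[a /andP[ai aj]]]|[ji]].
  split=> //; rewrite disjoint_subset; apply/subsetPn.
  exists a; first by rewrite ffunE finset.in_set.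
  by rewrite !inE negbK ffunE finset.in_set.
rewrite disjoint_subset => /subsetPn[a].
rewrite ffunE !inE negbK ffunE finset.in_set => aj ai.
apply/andP; split; first exact: ji.
by apply/existsP; exists a; rewrite ai.
Qed.

Let mW (j : 'I_n) : measurable_fun setT (W j).
Proof. by case: model => -[]. Qed.

Let mU (k : 'I_n * 'I_m) : measurable_fun setT (U k.1 k.2).
Proof. by case: model => -[]. Qed.

Let lawW (j : 'I_n) A : measurable A -> P (W j @^-1` A) = weight_law j A.
Proof.
move=> mA; case: model => _ Wi Wj _ _; move: Wi Wj; rewrite /weight_law.
case: wi => [w|] Wi Wj; last exact: Wj.
case: (eqVneq j i) => [ji|/eqP ji]; last by apply: Wj => // /val_inj.
rewrite Wi ?ji//= diracE preimage_cst; case: ifP => _; last exact: measure0.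
exact: probability_setT.
Qed.

Lemma edge_config_prob e :
  P (edge_config @^-1` [set e]) =
  (\prod_j \int[weight_law j]_x
     subset_weight (edge_prob alpha gamma n x) (e j))%:E.
Proof.
(* One event per vertex-group pair, prescribing presence or absence of the edge according to [e].
   All pairs are coupled, and the first component selects the weight. *)
pose G (k : 'I_n * 'I_m) := [set z : R * measurableTypeR R | (z.2 < p z.1) = (k.2 \in e k.1)].
have mG k : measurable (G k) by exact: measurable_edge_event.
rewrite [X in P X = _](_ : _ = section_event (fst : 'I_n * 'I_m -> 'I_n)
  (fun j => W j : T -> R) (fun k => U k.1 k.2 : T -> measurableTypeR R) G
  [set: 'I_n * 'I_m]%SET (fun=> setT) (fun=> setT)); last first.
  apply/seteqP; split=> x.
    move=> /= xe; split=> // -[j a]; rewrite finset.in_setT /G /=.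
    by rewrite -xe ffunE finset.in_set.
  move=> [_ h]; apply/ffunP => j; rewrite ffunE; apply/setP => a.
  by have := h (j, a); rewrite finset.in_setT finset.in_set.
rewrite (section_event_prob (la := uniform_prob (@ltr01 R)) (F := weight_law) mW mU)//.
  rewrite [X in (_ * X)%:E = _]big_pred0 ?mulr1; last by move=> k; rewrite finset.in_setT.
  congr EFin; apply: eq_bigr => j _; apply: eq_Rintegral => x _.
  rewrite /section_weight /subset_weight.
  rewrite (reindex (pair j))/=; last first.
    by exists snd => [a _ //|[j' a]]; rewrite inE /= => /andP[_ /eqP ->].
  apply: eq_big => [a|a _]; first by rewrite finset.in_setT eqxx.
  rewrite -uniform_prob_pedge /section_prob.
  by congr (fine (_ _)); apply/seteqP; split=> u; rewrite /xsection/= inE.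
move=> B C mB mC; case: model => _ _ _ lawU.
move=> /(_ (fun k => match k with inl j => B j | inr k => C k end)).
rewrite big_sumType/= => /(_ _)/wrap[|indep]; first by case.
have -> : \prod_j fine (weight_law j (B j)) = \prod_(j < n) fine (P (W j @^-1` B j)).
  by apply: eq_bigr => j _; rewrite lawW; last exact: mB.
have -> : \prod_k fine (uniform_prob (@ltr01 R) (C k)) =
    \prod_(k : 'I_n * 'I_m) fine (P (U k.1 k.2 @^-1` C k)).
  by apply: eq_bigr => -[j a] _ /=; rewrite lawU; last exact: mC.
rewrite -indep; congr (P _); apply/seteqP; split=> x; last first.
  move=> h; split=> [j|k]; first exact: (h (inl j) Logic.I).
  by rewrite finset.in_set0; exact: (h (inr k) Logic.I).
move=> [hB hC] [j|k] _; first exact: hB.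
by have := hC k; rewrite finset.in_set0.
Qed.

Lemma measurable_edge_config e : measurable (edge_config @^-1` [set e]).
Proof.
pose G (k : 'I_n * 'I_m) := [set z : R * measurableTypeR R | (z.2 < p z.1) = (k.2 \in e k.1)].
have mG k : measurable (G k) by exact: measurable_edge_event.
have := @measurable_section_event _ _ _ T R (measurableTypeR R) _ _ (fst : 'I_n * 'I_m -> 'I_n)
  (fun j => W j) (fun k => U k.1 k.2) G
  mW mU mG [set: 'I_n * 'I_m]%SET (fun=> setT) (fun=> setT)
  (fun=> measurableT) (fun=> measurableT).
congr (measurable _); apply/seteqP; split=> x.
  move=> [_ h]; apply/ffunP => j; rewrite ffunE; apply/setP => a.
  by have := h (j, a); rewrite finset.in_setT finset.in_set.
by move=> /= xe; split=> // -[j a]; rewrite finset.in_setT /G /= -xe ffunE finset.in_set.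
Qed.

Lemma integral_degree (f : nat -> R) :
  (\int[P]_x (f (degree alpha beta gamma n i W U x))%:E)%E =
  (\sum_e f (config_degree e) * \prod_j \int[weight_law j]_x
     subset_weight (edge_prob alpha gamma n x) (e j))%:E.
Proof.
transitivity (\int[P]_x \sum_e
    ((f (config_degree e))%:E * (\1_(edge_config @^-1` [set e]) x)%:E))%E.
  apply: eq_integral => x _; rewrite degree_edge_config (bigD1 (edge_config x))//=.
  rewrite indicE mem_set// mule1 big1 ?adde0// => e ne.
  rewrite indicE memNset ?mule0//= => xe; by rewrite xe eqxx in ne.
have iI e : P.-integrable setT (fun x => (\1_(edge_config @^-1` [set e]) x)%:E).
  apply: integrable_indic => //; last exact: measurable_edge_config.
rewrite integral_sum//; last by move=> e; apply: integrableZl => //; exact: iI.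
rewrite -sumEFin; apply: eq_bigr => e _; rewrite integralZl//; last exact: iI.
rewrite integral_indic//; last exact: measurable_edge_config.
by rewrite setIT [X in (_ * X)%E = _]edge_config_prob EFinM.
Qed.

Lemma measurable_degree : measurable_fun setT (degree alpha beta gamma n i W U).
Proof.
move=> _ A _; rewrite setTI.
rewrite (_ : _ @^-1` _ = \bigcup_(e in [set e | A (config_degree e)])
    (edge_config @^-1` [set e])).
  by apply: fin_bigcup_measurable => // e _; exact: measurable_edge_config.
apply/seteqP; split=> x /=; rewrite degree_edge_config.
  by move=> Ax; exists (edge_config x).
by move=> [e Ae ->].
Qed.

End configurations.

(* Summing first over the value at [i] decouples the other coordinates. *)
Lemma sum_ffun_pivot {R : comNzRingType} (I J : finType) (i : I) (h : J -> R)
    (g : I -> J -> R) (c : J -> J -> R) :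
  \sum_(e : {ffun I -> J}) h (e i) * (\prod_(j | j != i) c (e i) (e j)) *
    (\prod_j g j (e j)) =
  \sum_s h s * g i s * \prod_(j | j != i) \sum_a c s a * g j a.
Proof.
(* The value at [i] becomes a free variable [s], forced to equal [e i] by an indicator; for fixed
   [s] the summand is a product over coordinates and the sum factors. *)
pose X s j a := if j == i then (a == s)%:R * g i a else c s a * g j a.
transitivity (\sum_(e : {ffun I -> J}) \sum_s h s * \prod_j X s j (e j)).
  apply: eq_bigr => e _; rewrite (bigD1 (e i))//= [X in _ + X]big1 ?addr0.
    rewrite -mulrA; congr (_ * _).
    rewrite [in RHS](bigD1 i)//= [X in _ * X = _](bigD1 i)//= mulrCA.
    rewrite {1}/X eqxx eqxx mul1r; congr (_ * _).
    by rewrite -big_split/=; apply: eq_bigr => j /negbTE ji; rewrite /X ji.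
  by move=> s se; rewrite (bigD1 i)//= {1}/X eqxx eq_sym (negbTE se) !mul0r mulr0.
rewrite exchange_big/=; apply: eq_bigr => s _.
rewrite -mulr_sumr -bigA_distr_bigA (bigD1 i)//= mulrA; congr (_ * _ * _).
  rewrite (bigD1 s)//= {1}/X !eqxx mul1r big1 ?addr0// => a /negbTE as_.
  by rewrite /X eqxx as_ mul0r.
by apply: eq_bigr => j /negbTE ji; apply: eq_bigr => a _; rewrite /X ji.
Qed.

Section bounded_integrals.
Context {d} {T : measurableType d} {R : realType} (mu : probability T R).

Lemma integrable_itv01 (f : T -> R) : measurable_fun setT f ->
  (forall x, 0 <= f x <= 1) -> mu.-integrable setT (EFin \o f).
Proof.
move=> mf f01; apply: measurable_bounded_integrable => //.
  by rewrite ltey_eq fin_num_measure.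
exists 1; split => // M M1 x _ /=; have /andP[? ?] := f01 x.
by rewrite ger0_norm// (le_trans _ (ltW M1)).
Qed.

Lemma Rintegral_sum (I : Type) (s : seq I) (Q : pred I) (f : I -> T -> R) :
  (forall k, mu.-integrable setT (EFin \o f k)) ->
  \int[mu]_x (\sum_(k <- s | Q k) f k x) = \sum_(k <- s | Q k) \int[mu]_x f k x.
Proof.
move=> fI; rewrite /Rintegral.
under eq_integral do rewrite -sumEFin.
rewrite (integral_sum measurableT)//.
rewrite (eq_bigr (fun k => (\int[mu]_x f k x)%:E)) ?sumEFin// => k _.
by rewrite fineK//; apply: integrable_fin_num => //; exact: fI.
Qed.

Lemma Rintegral_cst_probability (c : R) : \int[mu]_x c = c.
Proof. by rewrite Rintegral_cst//= (@probability_setT _ _ _ mu) mulr1. Qed.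

End bounded_integrals.

(** * Exact generating function and deviation bound for the degree *)

Section degree_distribution.
Context {R : realType} (alpha beta gamma : R) (F : probability R R) (n : nat).

Let m := ngroups alpha beta n.
Let r := edge_prob alpha gamma n.

Let mr : measurable_fun setT r.
Proof. exact: measurable_edge_prob. Qed.

Let r01 x : 0 <= r x <= 1.
Proof. exact: edge_prob_itv. Qed.

(** Law of the set of groups of a vertex whose weight has law [mu]. *)
Definition mean_subset_weight (mu : probability R R) (S : {set 'I_m}) : R :=
  \int[mu]_x subset_weight (r x) S.

Let integrable_subset_weight (mu : probability R R) (S : {set 'I_m}) :
  mu.-integrable setT (EFin \o (fun x => subset_weight (r x) S)).
Proof.
apply: integrable_itv01.
  rewrite /subset_weight; apply: measurable_prod => a _; case: (a \in S) => //.
  exact: measurable_funB.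
move=> x; rewrite subset_weight_ge0//= /subset_weight.
apply: prodr_ile1 => a _.
by have /andP[? ?] := r01 x; case: ifP => _; apply/andP; split; lra.
Qed.

Lemma mean_subset_weight_ge0 mu S : 0 <= mean_subset_weight mu S.
Proof. by apply: Rintegral_ge0 => x _; exact: subset_weight_ge0. Qed.

Lemma sum_mean_subset_weight mu : \sum_S mean_subset_weight mu S = 1.
Proof.
rewrite -Rintegral_sum; last exact: integrable_subset_weight.
under eq_Rintegral do rewrite sum_subset_weight.
exact: Rintegral_cst_probability.
Qed.

Lemma sum_mean_subset_weight_disjoint mu (Z : {set 'I_m}) :
  \sum_(S : {set 'I_m} | [disjoint S & Z]) mean_subset_weight mu S =
  \int[mu]_x (1 - r x) ^+ #|Z|.
Proof.
rewrite -Rintegral_sum; last exact: integrable_subset_weight.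
by under eq_Rintegral do rewrite sum_subset_weight_disjoint.
Qed.

Lemma sum_mean_subset_weight_card mu :
  \sum_S mean_subset_weight mu S * #|S|%:R = m%:R * \int[mu]_x r x.
Proof.
transitivity (\sum_(S : {set 'I_m}) \int[mu]_x (#|S|%:R * subset_weight (r x) S)).
  by apply: eq_bigr => S _; rewrite mulrC RintegralZl//; exact: integrable_subset_weight.
rewrite -Rintegral_sum; last first.
  move=> S; rewrite (_ : _ \o _ = (fun x =>
    (#|S|%:R)%:E * (EFin \o (fun x => subset_weight (r x) S)) x)%E); last first.
    by apply/funext => x /=; rewrite EFinM.
  by apply: integrableZl => //; exact: integrable_subset_weight.
rewrite -RintegralZl//; last exact: integrable_itv01.
apply: eq_Rintegral => x _; rewrite -sum_subset_weight_card.
by apply: eq_bigr => S _; rewrite mulrC.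
Qed.

Context (i : 'I_n) {d} {T : measurableType d} (P : probability T R).
Variables (W : nat -> T -> R) (U : nat -> nat -> T -> R).

(** The power t^D is a product over j != i of factors depending only on the group sets of i and j: 1
    if they are disjoint, t otherwise. [sum_ffun_pivot] then applies, and averaging over the set of
    j gives t + (1 - t) q, with q the probability of missing S. *)
Lemma degree_pgf (w t : R) :
  GnmF_model alpha beta gamma F n i (Some w) P W U ->
  (\int[P]_x (t ^+ degree alpha beta gamma n i W U x)%:E)%E =
  (\sum_(S : {set 'I_m}) subset_weight (r w) S *
    (t + (1 - t) * \int[F]_x (1 - r x) ^+ #|S|) ^+ n.-1)%:E.
Proof.
move=> model; rewrite (integral_degree model); congr EFin.
pose g j (S : {set 'I_m}) := mean_subset_weight (weight_law F i (Some w) j) S.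
pose c (S A : {set 'I_m}) : R := if [disjoint A & S] then 1 else t.
transitivity (\sum_(e : {ffun 'I_n -> {set 'I_m}})
   1 * (\prod_(j | j != i) c (e i) (e j)) * (\prod_j g j (e j))).
  apply: eq_bigr => e _; congr (_ * _).
  rewrite mul1r /config_degree -prodr_const [RHS]big_mkcond/= [LHS]big_mkcond/=.
  apply: eq_bigr => j _; rewrite finset.in_set /c.
  by case: (j != i) => //=; case: [disjoint e j & e i]%B.
rewrite (sum_ffun_pivot _ (fun=> 1)); apply: eq_bigr => S _.
rewrite mul1r; congr (_ * _).
  rewrite /g /weight_law eqxx /mean_subset_weight /Rintegral integral_dirac//.
    by rewrite diracT mul1e.
  by case/integrableP: (integrable_subset_weight F S).
rewrite (eq_bigr (fun=> t + (1 - t) * \int[F]_x (1 - r x) ^+ #|S|)); last first.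
  move=> j /negbTE ji; rewrite /g /weight_law ji.
  rewrite -sum_mean_subset_weight_disjoint [in RHS]big_mkcond/= mulr_sumr.
  have tE : t = \sum_A t * mean_subset_weight F A.
    by rewrite -mulr_sumr sum_mean_subset_weight mulr1.
  rewrite [X in _ = X + _]tE -big_split/=.
  by apply: eq_bigr => A _; rewrite /c; case: ifP => _; ring.
rewrite prodr_const; congr (_ ^+ _).
by have := cardC1 i; rewrite card_ord => <-; apply: eq_card.
Qed.

(** The degree vanishes when i has no group, so |f(D) - f(0)| is at most 2M times the number of
    groups of i, whose mean is m E[p(W)]. Here the weight of i is random as well. *)
Lemma degree_deviation (f : nat -> R) (M : R) : (forall k, `|f k| <= M) ->
  GnmF_model alpha beta gamma F n i None P W U ->
  exists2 y : R,
    (\int[P]_x (f (degree alpha beta gamma n i W U x))%:E)%E = y%:E &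
    `|y - f 0%N| <= 2 * M * (m%:R * \int[F]_x r x).
Proof.
move=> fM model; rewrite (integral_degree model); eexists; first by [].
pose g (j : 'I_n) := mean_subset_weight F.
have sum_h (h : {set 'I_m} -> R) :
    \sum_(e : {ffun 'I_n -> {set 'I_m}}) h (e i) * \prod_j g j (e j) =
    \sum_S h S * mean_subset_weight F S.
  transitivity (\sum_(e : {ffun 'I_n -> {set 'I_m}})
     h (e i) * (\prod_(j | j != i) 1) * (\prod_j g j (e j))).
    by apply: eq_bigr => e _; rewrite big1_eq mulr1.
  rewrite (sum_ffun_pivot _ h g (fun _ _ => 1)); apply: eq_bigr => S _.
  rewrite [X in _ * X]big1 ?mulr1// => j _; rewrite -[RHS](sum_mean_subset_weight F).
  by apply: eq_bigr => A _; rewrite mul1r.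
have g0 (e : {ffun 'I_n -> {set 'I_m}}) : 0 <= \prod_j g j (e j).
  by apply: prodr_ge0 => j _; exact: mean_subset_weight_ge0.
have -> : f 0%N = \sum_(e : {ffun 'I_n -> {set 'I_m}}) f 0%N * \prod_j g j (e j).
  by rewrite (sum_h (fun=> f 0%N)) -mulr_sumr sum_mean_subset_weight mulr1.
rewrite -[\int[F]_x r x]mulr1 mulrA mulr1 -sum_mean_subset_weight_card mulr_sumr.
rewrite [leRHS](eq_bigr (fun S : {set 'I_m} =>
  2 * M * #|S|%:R * mean_subset_weight F S)); last first.
  by move=> S _; ring.
rewrite -(sum_h (fun S : {set 'I_m} => 2 * M * #|S|%:R)) -sumrB.
apply: (le_trans (ler_norm_sum _ _ _)); apply: ler_sum => e _.
rewrite -mulrBl normrM (ger0_norm (g0 e)) ler_wpM2r//.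
have M0 : 0 <= M by exact: le_trans (fM 0%N).
have [ei|ei] := eqVneq #|e i| 0%N.
  rewrite (_ : config_degree _ _ = 0%N) ?subrr ?normr0 ?ei ?mulr0//.
  apply/eqP; rewrite cards_eq0; apply/eqP/setP => j; rewrite finset.in_set finset.in_set0.
  have /eqP := ei; rewrite cards_eq0 => /eqP ->.
  rewrite disjoint_sym disjoint_subset; case: (j != i) => //=.
  by rewrite (introT fintype.subsetP)// => a; rewrite finset.in_set0.
rewrite (le_trans (ler_normB _ _))// (le_trans (lerD (fM _) (fM _)))//.
rewrite -[leLHS]mulr1 (_ : M + M = 2 * M); last by ring.
by rewrite ler_wpM2l ?mulr_ge0// ler1n lt0n.
Qed.

End degree_distribution.

(** * Scaling and real limits *)

Section real_bounds.
Context {R : realType}.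
Implicit Types x a b : R.

Lemma expr_onem_ge x k : 0 <= x <= 1 -> 1 - k%:R * x <= (1 - x) ^+ k.
Proof.
move=> /andP[x0 x1]; elim: k => [|k IH]; first by rewrite mul0r subr0 expr0.
rewrite exprS (le_trans _ (ler_wpM2l _ IH)) ?subr_ge0// -natr1.
have : 0 <= k%:R * x ^+ 2 by rewrite mulr_ge0 ?sqr_ge0.
by nra.
Qed.

Lemma expr_onem_le x k : 0 <= x <= 1 ->
  (1 - x) ^+ k <= 1 - k%:R * x + (k%:R * x) ^+ 2.
Proof.
move=> /andP[x0 x1]; elim: k => [|k IH].
  by rewrite mul0r subr0 expr0 expr0n addr0.
rewrite exprS (le_trans (ler_wpM2l _ IH)) ?subr_ge0// -natr1.
have k0 : 0 <= k%:R :> R by [].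
have : 0 <= k%:R * x ^+ 2 by rewrite mulr_ge0 ?sqr_ge0.
have : 0 <= k%:R ^+ 2 * x ^+ 3 by rewrite mulr_ge0 ?sqr_ge0 ?exprn_ge0.
have : 0 <= x ^+ 2 by rewrite sqr_ge0.
by nra.
Qed.

Lemma normr_subXX_le a b N : 0 <= a <= 1 -> 0 <= b <= 1 ->
  `|a ^+ N - b ^+ N| <= N%:R * `|a - b|.
Proof.
move=> /andP[a0 a1] /andP[b0 b1]; rewrite subrXX normrM mulrC.
rewrite ler_wpM2r// (le_trans (ler_norm_sum _ _ _))//.
rewrite (le_trans (y := \sum_(j < N) 1))//; last by rewrite sumr_const card_ord.
apply: ler_sum => j _; rewrite ger0_norm ?mulr_ge0 ?exprn_ge0//.
by rewrite mulr_ile1 ?exprn_ge0 ?exprn_ile1.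
Qed.

Lemma expr_onem_le_expR x k : 0 <= x <= 1 -> (1 - x) ^+ k <= expR (- (k%:R * x)).
Proof.
move=> /andP[x0 x1]; rewrite -mulrN expRM_natl.
by apply: lerXn2r; rewrite ?nnegrE ?subr_ge0 ?expR_ge0// expR_ge1Dx.
Qed.

(** Uses 1 + u <= e^u at u = x / (1 - x), where 1 + u = 1 / (1 - x). *)
Lemma expR_le_expr_onem x k : 0 <= x < 1 ->
  expR (- (k%:R * x / (1 - x))) <= (1 - x) ^+ k.
Proof.
move=> /andP[x0 x1]; have x1' : 0 < 1 - x by rewrite subr_gt0.
rewrite -mulrA -mulrN expRM_natl.
apply: lerXn2r; rewrite ?nnegrE ?expR_ge0 ?(ltW x1')//.
rewrite expRN -[leRHS]invrK lef_pV2 ?posrE ?expR_gt0 ?invr_gt0//.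
rewrite (le_trans _ (expR_ge1Dx _))//.
rewrite le_eqVlt; apply/orP; left; apply/eqP; field.
by rewrite gt_eqF.
Qed.

End real_bounds.

Section real_limits.
Context {R : realType}.

Lemma cvg_expr_onem (x : R^nat) (k : nat -> nat) (l : R) :
  (forall n, 0 <= x n <= 1) -> x n @[n --> \oo] --> (0 : R) ->
  (k n)%:R * x n @[n --> \oo] --> l ->
  (1 - x n) ^+ k n @[n --> \oo] --> expR (- l).
Proof.
move=> x01 x0 kx.
have expR_cts (u : R^nat) (c : R) : u n @[n --> \oo] --> c ->
    expR (- u n) @[n --> \oo] --> expR (- c).
  by move=> uc; apply: continuous_cvg; [exact: continuous_expR|exact: cvgN].
have lo : expR (- ((k n)%:R * x n / (1 - x n))) @[n --> \oo] --> expR (- l).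
  apply: expR_cts; rewrite -[l]divr1; apply: cvgM => //.
  apply: cvgV; first exact: oner_neq0.
  by rewrite -[X in _ --> X]subr0; apply: cvgB => //; exact: cvg_cst.
apply: (squeeze_cvgr _ lo (expR_cts _ _ kx)); near=> n.
rewrite expr_onem_le_expR// andbT expR_le_expr_onem//.
have /andP[-> _] /= := x01 n.
by near: n; apply: (cvgr_lt _ x0).
Unshelve. all: by end_near. Qed.

Lemma cvg_powRN (a : R) : 0 < a -> n%:R `^ (- a) @[n --> \oo] --> (0 : R).
Proof.
move=> a0; under eq_fun do rewrite powRN.
apply/(gtr0_cvgV0 (f := fun n : nat => n%:R `^ a : R)).
  by near=> n; rewrite powR_gt0// ltr0n; near: n; exact: nbhs_infty_gt.
apply/cvgryPge => A; near=> n.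
(* The threshold for n is the a-th root of this maximum, which is positive even if A is not. *)
have A1 : 0 <= Num.max A 1 by rewrite le_max ler01 orbT.
rewrite (le_trans (y := Num.max A 1)) ?le_max ?lexx//.
have -> : Num.max A 1 = (Num.max A 1 `^ a^-1) `^ a.
  by rewrite -powRrM mulVf ?gt_eqF// powRr1.
apply: ge0_ler_powR; rewrite ?nnegrE ?powR_ge0 ?(ltW a0)//.
by near: n; exact: nbhs_infty_ger.
Unshelve. all: by end_near. Qed.

End real_limits.

(** * Orders of magnitude of the edge scale and of the number of groups *)

Section scaling.
Context {R : realType} (alpha beta gamma : R).
Hypotheses (alpha0 : 0 < alpha) (beta0 : 0 < beta) (gamma0 : 0 < gamma).

(** Edge probability per unit of weight, before truncation at 1. The quantity that governs every
    regime is n m times its square. *)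
Definition edge_scale (n : nat) : R := gamma * n%:R `^ (- (1 + alpha) / 2).

Let m := ngroups alpha beta.

Lemma edge_scale_ge0 n : 0 <= edge_scale n.
Proof. by rewrite mulr_ge0 ?powR_ge0// ltW. Qed.

Lemma pedgeE n w : pedge alpha gamma n w = Num.min (w * edge_scale n) 1.
Proof. by rewrite /pedge /edge_scale; congr (Num.min _ _); ring. Qed.

Lemma cvg_edge_scale : edge_scale n @[n --> \oo] --> (0 : R).
Proof.
rewrite -[X in _ --> X](mulr0 gamma); apply: cvgMr.
under eq_fun do rewrite mulNr; apply: cvg_powRN; by rewrite divr_gt0 ?addr_gt0 ?ltr01 ?ltr0n.
Qed.

Lemma edge_scale_sqr n : (0 < n)%N ->
  n%:R * edge_scale n ^+ 2 = gamma ^+ 2 * n%:R `^ (- alpha).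
Proof.
move=> n0; have n0' : (n%:R : R) != 0 by rewrite pnatr_eq0 -lt0n.
rewrite /edge_scale exprMn mulrCA; congr (_ * _).
rewrite -powR_mulrn ?powR_ge0// -powRrM -{1}[n%:R]powRr1// -powRD.
  by congr (_ `^ _); field.
by rewrite n0' implybT.
Qed.

Lemma ngroups_itv n :
  beta * n%:R `^ alpha - 1 <= (m n)%:R <= beta * n%:R `^ alpha.
Proof.
have b0 : 0 <= beta * n%:R `^ alpha by rewrite mulr_ge0 ?powR_ge0// ltW.
have /andP[-> h] := truncn_itv b0.
by rewrite andbT lerBlDr natr1; exact: ltW.
Qed.

(** Without the integer part of m the middle term would be exactly beta gamma^2; rounding loses less
    than one group, which costs at most gamma^2 n^(-alpha). *)
Let density_itv n : (0 < n)%N ->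
  gamma ^+ 2 * (beta - n%:R `^ (- alpha)) <=
    n%:R * (m n)%:R * edge_scale n ^+ 2 <= beta * gamma ^+ 2.
Proof.
move=> n0; have /andP[lo hi] := ngroups_itv n.
rewrite (mulrAC n%:R) edge_scale_sqr//.
have n0' : 0 < (n%:R : R) by rewrite ltr0n.
have -> : n%:R `^ (- alpha) = (n%:R `^ alpha)^-1 :> R by rewrite powRN.
set q := n%:R `^ alpha in lo hi *; have q0 : 0 < q by exact: powR_gt0.
rewrite -[X in _ <= X <= _]mulrA (mulrC beta); apply/andP; split.
  apply: ler_wpM2l; first exact: sqr_ge0.
  rewrite [leRHS]mulrC ler_pdivlMr// mulrBl mulVf ?gt_eqF//.
by apply: ler_wpM2l; [exact: sqr_ge0|rewrite mulrC ler_pdivrMr].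
Qed.

Lemma density_le n : n%:R * (m n)%:R * edge_scale n ^+ 2 <= beta * gamma ^+ 2.
Proof.
case: n => [|n]; last by case/andP: (density_itv (ltn0Sn n)).
by rewrite !mul0r mulr_ge0 ?sqr_ge0// ltW.
Qed.

Lemma cvg_density :
  n%:R * (m n)%:R * edge_scale n ^+ 2 @[n --> \oo] --> beta * gamma ^+ 2.
 Proof.
apply: (@squeeze_cvgr _ _ _ _ (fun n => gamma ^+ 2 * (beta - n%:R `^ (- alpha)))
  (fun=> beta * gamma ^+ 2)).
- by near=> n; apply: density_itv; near: n; exact: nbhs_infty_gt.
- rewrite mulrC; apply: cvgMr; rewrite -[X in _ --> X]subr0.
  by apply: cvgB; [exact: cvg_cst|exact: cvg_powRN].
- exact: cvg_cst.
Unshelve. all: by end_near. Qed.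

Lemma edge_scale_critical n : alpha = 1 -> (0 < n)%N -> n%:R * edge_scale n = gamma.
Proof.
move=> alpha1 n0; rewrite /edge_scale alpha1 (_ : - (1 + 1) / 2 = -1); last by field.
by rewrite powR_inv1// mulrCA mulfV ?mulr1// pnatr_eq0 -lt0n.
Qed.

Let powR_half n b : (0 < n)%N ->
  n%:R `^ b * n%:R `^ (- (1 + alpha) / 2) = n%:R `^ (b - (1 + alpha) / 2) :> R.
Proof.
move=> n0; rewrite -powRD; first by congr (_ `^ _); field.
by rewrite pnatr_eq0 -lt0n n0 implybT.
Qed.

Lemma cvg_edge_scale_dense : 1 < alpha ->
  n%:R * edge_scale n @[n --> \oo] --> (0 : R).
Proof.
move=> alpha1; rewrite -[X in _ --> X](mulr0 gamma).
apply: (@cvg_trans _ ((gamma * n%:R `^ (- ((alpha - 1) / 2))) @[n --> \oo])).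
  apply: near_eq_cvg; near=> n; rewrite /edge_scale [RHS]mulrCA; congr (_ * _).
  rewrite -{2}[n%:R]powRr1// powR_half; last by near: n; exact: nbhs_infty_gt.
  by congr (_ `^ _); field.
by apply: cvgMr; apply: cvg_powRN; rewrite divr_gt0 ?subr_gt0.
Unshelve. all: by end_near. Qed.

Lemma cvg_edge_scale_sparse : alpha < 1 ->
  (m n)%:R * edge_scale n @[n --> \oo] --> (0 : R).
Proof.
move=> alpha1.
apply: (@squeeze_cvgr _ _ _ _ (fun=> 0)
  (fun n => beta * gamma * n%:R `^ (- ((1 - alpha) / 2)))).
- near=> n; rewrite mulr_ge0 ?edge_scale_ge0//=.
  have /andP[_ hi] := ngroups_itv n.
  rewrite (le_trans (ler_wpM2r (edge_scale_ge0 n) hi))// /edge_scale mulrACA.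
  rewrite powR_half; last by near: n; exact: nbhs_infty_gt.
  by rewrite (_ : alpha - _ = - ((1 - alpha) / 2)); last by field.
- exact: cvg_cst.
- rewrite -[X in _ --> X](mulr0 (beta * gamma)).
  by apply: cvgMr; apply: cvg_powRN; rewrite divr_gt0 ?subr_gt0.
Unshelve. all: by end_near. Qed.

End scaling.

(** * The mean edge probability *)

Section almost_sure_comparison.
Context {d} {T : measurableType d} {R : realType} (mu : probability T R).

(** Needed because [F] is a law on the whole line: the comparisons with x pi are made only for x >
    0, a set of full measure. *)
Lemma le_Rintegral_as (D : set T) (f g : T -> R) :
  measurable D -> mu D = 1%E ->
  mu.-integrable setT (EFin \o f) -> mu.-integrable setT (EFin \o g) ->
  (forall x, D x -> f x <= g x) ->
  \int[mu]_x f x <= \int[mu]_x g x.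
Proof.
move=> mD muD fI gI fg.
have muDC : mu (~` D) = 0%E by rewrite probability_setC// muD subee.
have restrictD h : mu.-integrable setT (EFin \o h) ->
    \int[mu]_x h x = \int[mu]_(x in D) h x.
  move=> hI; rewrite /Rintegral -[in RHS](setCK D) -setTD.
  by rewrite -(negligible_integral (measurableC mD)).
rewrite !restrictD//; apply: le_Rintegral => //.
- exact: integrableS fI.
- exact: integrableS gI.
Qed.

End almost_sure_comparison.

Section mean_edge_probability.
Context {R : realType} (alpha gamma : R) (F : probability R R) (n : nat).
Hypothesis gamma0 : 0 < gamma.
Hypothesis Fpos : F [set x : R | 0 < x] = 1%E.
Hypothesis Fint : F.-integrable [set: R] (fun x => x%:E).
Hypothesis Fmean : (\int[F]_x x%:E = 1)%E.

Let r := edge_prob alpha gamma n.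
Let pi_ := edge_scale alpha gamma n.

Let pi0 : 0 <= pi_. Proof. exact: edge_scale_ge0. Qed.

Let r01 x : 0 <= r x <= 1. Proof. exact: edge_prob_itv. Qed.

Definition mean_edge_prob : R := \int[F]_x r x.

Definition tail_part (A x : R) : R := x * \1_(`]A, +oo[%classic : set R) x.

Definition tail_mean (A : R) : R := \int[F]_x tail_part A x.

Lemma edge_prob_pos x : 0 <= x -> r x = Num.min (x * pi_) 1.
Proof.
move=> x0; rewrite /r edge_probE pedgeE//.
by rewrite le_min ler01 mulr_ge0.
Qed.

Let rI : F.-integrable setT (EFin \o r).
Proof. by apply: integrable_itv01 => //; exact: measurable_edge_prob. Qed.

Let tail_partI A : F.-integrable setT (EFin \o tail_part A).
Proof.
apply: (le_integrable measurableT _ _ Fint).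
  by apply/measurable_EFinP; apply: measurable_funM.
move=> x _ /=; rewrite lee_fin /tail_part normrM indicE.
by rewrite -[leRHS]mulr1 ler_wpM2l// ger0_norm// lern1 leq_b1.
Qed.

(** The comparison functions below are combinations of 1, the edge probability, the weight and its
    tail, so integrability and the integral are settled once for all of them. *)
Let affine (a b c e A x : R) := a + b * r x + c * x + e * tail_part A x.

Let cstI (a : R) : F.-integrable setT (EFin \o (fun=> a)).
Proof. exact: finite_measure_integrable_cst. Qed.

Let integrable_add (f g : R -> R) : F.-integrable setT (EFin \o f) ->
  F.-integrable setT (EFin \o g) ->
  F.-integrable setT (EFin \o (fun x => f x + g x)).
Proof. by move=> fI gI; exact: (integrableD measurableT fI gI). Qed.

Let integrable_scale k (f : R -> R) : F.-integrable setT (EFin \o f) ->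
  F.-integrable setT (EFin \o (fun x => k * f x)).
Proof. by move=> fI; exact: (integrableZl measurableT k fI). Qed.

Let affineI a b c e A : F.-integrable setT (EFin \o affine a b c e A).
Proof.
exact: (integrable_add (integrable_add (integrable_add (cstI a)
  (integrable_scale b rI)) (integrable_scale c Fint))
  (integrable_scale e (tail_partI A))).
Qed.

Let Rintegral_affine a b c e A :
  \int[F]_x affine a b c e A x = a + b * mean_edge_prob + c + e * tail_mean A.
Proof.
have bI := integrable_scale b rI; have cI := integrable_scale c Fint.
have eI := integrable_scale e (tail_partI A).
have abI := integrable_add (cstI a) bI; have abcI := integrable_add abI cI.
rewrite /affine (RintegralD measurableT abcI eI) (RintegralD measurableT abI cI).
rewrite (RintegralD measurableT (cstI a) bI) !RintegralZl//.
by rewrite Rintegral_cst_probability [\int[F]_x x]/Rintegral Fmean mulr1.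
Qed.

Let mD : measurable [set x : R | 0 < x].
Proof.
rewrite (_ : [set _ | _] = `]0, +oo[%classic)//.
by apply/seteqP; split=> u /=; rewrite in_itv/= andbT.
Qed.

Let tail_partE A x : 0 < x ->
  tail_part A x = if A < x then x else 0.
Proof.
move=> x0; rewrite /tail_part indicE; case: ifPn => Ax.
  by rewrite mem_set ?mulr1//= in_itv/= Ax.
by rewrite memNset ?mulr0//= in_itv/= (negbTE Ax).
Qed.

Lemma tail_mean_ge0 A : 0 <= tail_mean A.
Proof.
have := le_Rintegral_as mD Fpos (cstI 0) (tail_partI A).
rewrite Rintegral_cst_probability; apply => x /= x0.
by rewrite tail_partE//; case: ifP => // _; exact: ltW.
Qed.

Lemma mean_edge_prob_itv : 0 <= mean_edge_prob <= 1.
Proof.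
apply/andP; split; first by apply: Rintegral_ge0 => x _; case/andP: (r01 x).
have := le_Rintegral_as mD Fpos rI (affineI 1 0 0 0 0).
rewrite Rintegral_affine !mul0r !addr0; apply => x /= x0.
by rewrite /affine !mul0r !addr0; case/andP: (r01 x).
Qed.

Lemma mean_edge_prob_le : mean_edge_prob <= pi_.
Proof.
have := le_Rintegral_as mD Fpos rI (affineI 0 0 pi_ 0 0).
rewrite Rintegral_affine !mul0r !addr0 !add0r; apply => x /= x0.
by rewrite /affine !mul0r !addr0 !add0r edge_prob_pos ?ge_min ?(ltW x0)// mulrC lexx.
Qed.

(** For x <= A the truncation at 1 is inactive since A pi <= 1; for x > A the contribution is
    bounded below by 0, which loses pi times the tail mean. *)
Lemma mean_edge_prob_ge A : A * pi_ <= 1 ->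
  pi_ * (1 - tail_mean A) <= mean_edge_prob.
Proof.
move=> Api.
have := le_Rintegral_as mD Fpos (affineI 0 0 pi_ (- pi_) A) rI.
rewrite Rintegral_affine !mul0r !add0r mulrBr mulr1 mulNr; apply => x /= x0.
rewrite /affine tail_partE// edge_prob_pos ?(ltW x0)// le_min !mul0r !add0r.
case: ltP => [Ax|xA].
  by rewrite mulNr subrr ler01 mulr_ge0 ?(ltW x0).
rewrite mulr0 addr0 mulrC lexx/= (le_trans _ Api)//.
exact: ler_wpM2r.
Qed.

Lemma onem_edge_prob_itv k x : 0 <= (1 - r x) ^+ k <= 1.
Proof.
have /andP[? ?] := r01 x.
by rewrite exprn_ge0 ?subr_ge0//= exprn_ile1 ?subr_ge0//; lra.
Qed.

Lemma integrable_onem_edge_prob k :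
  F.-integrable setT (EFin \o (fun x => (1 - r x) ^+ k)).
Proof.
apply: integrable_itv01 => [|x]; last exact: onem_edge_prob_itv.
apply: measurable_funX; apply: measurable_funB => //.
exact: measurable_edge_prob.
Qed.

Lemma mean_onem_edge_prob_ge k :
  1 - k%:R * mean_edge_prob <= \int[F]_x (1 - r x) ^+ k.
Proof.
have kI := integrable_onem_edge_prob k.
have := le_Rintegral_as mD Fpos (affineI 1 (- k%:R) 0 0 0) kI.
rewrite Rintegral_affine !mul0r !addr0 mulNr; apply => x /= x0.
by rewrite /affine !mul0r !addr0 mulNr expr_onem_ge.
Qed.

(** Pointwise, for x <= A the quadratic term satisfies r(x)^2 <= pi^2 A x, which integrates to pi^2
    A because the mean is 1. For x > A the power is at most 1, and k x pi compensates the subtracted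
    k r(x). *)
Lemma mean_onem_edge_prob_le k A : 0 <= A ->
  \int[F]_x (1 - r x) ^+ k <= 1 - k%:R * mean_edge_prob +
    (k%:R ^+ 2 * pi_ ^+ 2 * A + k%:R * pi_ * tail_mean A).
Proof.
move=> A0.
have kI := integrable_onem_edge_prob k.
have := le_Rintegral_as mD Fpos kI
  (affineI 1 (- k%:R) (k%:R ^+ 2 * pi_ ^+ 2 * A) (k%:R * pi_) A).
rewrite Rintegral_affine mulNr -addrA; apply => x /= x0.
have /andP[rx0 rx1] := r01 x.
have rx : r x <= x * pi_ by rewrite edge_prob_pos ?ge_min ?lexx// ltW.
have k0 : 0 <= k%:R :> R by [].
rewrite /affine tail_partE//; case: ltP => [Ax|xA].
  have : (1 - r x) ^+ k <= 1 by rewrite exprn_ile1 ?subr_ge0//; lra.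
  have : 0 <= k%:R * (x * pi_ - r x) by rewrite mulr_ge0 ?subr_ge0.
  have : 0 <= k%:R ^+ 2 * pi_ ^+ 2 * A * x by rewrite !mulr_ge0 ?sqr_ge0// ltW.
  by lra.
have := expr_onem_le k (r01 x).
have : k%:R ^+ 2 * r x ^+ 2 <= k%:R ^+ 2 * (pi_ ^+ 2 * A * x).
  apply: ler_wpM2l; first exact: sqr_ge0.
  rewrite expr2 (le_trans (ler_pM rx0 rx0 rx rx))//.
  rewrite (_ : x * pi_ * (x * pi_) = pi_ ^+ 2 * x * x); last by ring.
  by apply: ler_wpM2r; [exact: ltW|apply: ler_wpM2l => //; exact: sqr_ge0].
by rewrite exprMn; lra.
Qed.

Lemma tail_mean_small e : 0 < e -> exists2 A, 0 < A & tail_mean A <= e.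
Proof.
move=> e0.
have : (\int[F]_x (tail_part k%:R x)%:E)%E @[k --> \oo] --> (\int[F]_x (cst 0 x : \bar R))%E.
  apply: (@dominated_cvg _ _ _ F _ measurableT _ _ (fun x => `|x%:E|%E)) => //.
  - by move=> k; case/integrableP: (tail_partI k%:R).
  - move=> x _; apply: cvg_near_cst; near=> k.
    rewrite /= /tail_part indicE memNset ?mulr0//= in_itv/= andbT.
    apply/negP; rewrite -leNgt; near: k; exact: nbhs_infty_ger.
  - exact: integrable_abse.
  - move=> k x _ /=; rewrite lee_fin /tail_part normrM indicE.
    by rewrite -[leRHS]mulr1 ler_wpM2l// ger0_norm// lern1 leq_b1.
rewrite integral0 => /fine_cvgP[_ /cvgr_le/(_ e e0)] [k _ hk].
(* The successor makes the cutoff positive. *)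
exists k.+1%:R; first by rewrite ltr0n.
exact: (hk k.+1 (leqnSn k)).
Unshelve. all: by end_near. Qed.

End mean_edge_probability.

(** * Limit of the generating function *)

Section pgf_limit.
Context {R : realType} (alpha beta gamma : R) (F : probability R R).
Hypotheses (alpha0 : 0 < alpha) (beta0 : 0 < beta) (gamma0 : 0 < gamma).
Hypothesis Fpos : F [set x : R | 0 < x] = 1%E.
Hypothesis Fint : F.-integrable [set: R] (fun x => x%:E).
Hypothesis Fmean : (\int[F]_x x%:E = 1)%E.
Variables (w t : R).
Hypotheses (w0 : 0 < w) (t01 : 0 <= t <= 1).

Let m := ngroups alpha beta.
Let r := edge_prob alpha gamma.
Let pi_ := edge_scale alpha gamma.
Let mu := mean_edge_prob alpha gamma F.
Let s := 1 - t.

Definition degree_pgf_sum n : R :=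
  \sum_(S : {set 'I_(m n)}) subset_weight (r n w) S *
    (t + (1 - t) * \int[F]_x (1 - r n x) ^+ #|S|) ^+ n.-1.

(* The probability generating function of a sum of Bin(m, p) independent
   Bin(n - 1, mu) variables, [p] being the edge probability of weight [w]. *)
Definition compound_pgf n : R :=
  (1 - r n w * (1 - (1 - (1 - t) * mu n) ^+ n.-1)) ^+ m n.

Let s01 : 0 <= s <= 1.
Proof. by rewrite /s; case/andP: t01 => *; apply/andP; split; lra. Qed.

Let pi0 n : 0 <= pi_ n. Proof. exact: edge_scale_ge0. Qed.

Let r01 n x : 0 <= r n x <= 1. Proof. exact: edge_prob_itv. Qed.

Let mu01 n : 0 <= mu n <= 1. Proof. exact: mean_edge_prob_itv. Qed.

Let smu01 n : 0 <= s * mu n <= 1.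
Proof.
have /andP[s0 s1] := s01; have /andP[mu0 mu1] := mu01 n.
by rewrite mulr_ge0//= mulr_ile1.
Qed.

Let rw_le n : r n w <= w * pi_ n.
Proof. by rewrite /r edge_prob_pos ?ge_min ?lexx// ltW. Qed.

(** Both bases, t + (1 - t) E[(1 - p(W))^k] and (1 - s mu)^k, are close to 1 - s k mu. The first
    deviates by the truncated error with constant A, the second by at most (k s mu)^2 <= k^2 pi^2,
    whence A + 1; raising to the power n - 1 multiplies the distance by at most n - 1. *)
Let summand_le n k A : 0 <= A ->
  `|(t + (1 - t) * \int[F]_x (1 - r n x) ^+ k) ^+ n.-1 -
    ((1 - s * mu n) ^+ n.-1) ^+ k| <=
  n.-1%:R * (k%:R ^+ 2 * (pi_ n ^+ 2 * (A + 1)) +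
             k%:R * (pi_ n * tail_mean F A)).
Proof.
move=> A0; rewrite [in X in _ - X]exprAC.
have /andP[s0 s1] := s01; have /andP[b0 b1] := smu01 n.
have /andP[mu0 mu1] := mu01 n.
have mupi : mu n <= pi_ n by exact: mean_edge_prob_le.
have tl0 : 0 <= tail_mean F A by exact: tail_mean_ge0.
set Q := \int[F]_x _.
have Qge : 1 - k%:R * mu n <= Q by exact: mean_onem_edge_prob_ge.
have Qle : Q <= 1 - k%:R * mu n +
    (k%:R ^+ 2 * pi_ n ^+ 2 * A + k%:R * pi_ n * tail_mean F A).
  exact: mean_onem_edge_prob_le.
have Q01 : 0 <= Q <= 1.
  have k01 := onem_edge_prob_itv alpha gamma n k.
  apply/andP; split; first by apply: Rintegral_ge0 => x _; case/andP: (k01 x).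
  rewrite -[leRHS](Rintegral_cst_probability F); apply: le_Rintegral => //.
  - exact: integrable_onem_edge_prob.
  - by apply: integrable_itv01 => // x; rewrite ler01 lexx.
  - by move=> x _; case/andP: (k01 x).
have bge := expr_onem_ge k (smu01 n).
have ble := expr_onem_le k (smu01 n).
apply: (le_trans (normr_subXX_le _ _ _)).
- by have /andP[? ?] := Q01; rewrite /s in s0 s1; apply/andP; split; nra.
- by rewrite exprn_ge0 ?subr_ge0//= exprn_ile1 ?subr_ge0//; lra.
apply: ler_wpM2l => //.
have k0 : 0 <= k%:R :> R by [].
have ksmu : (k%:R * (s * mu n)) ^+ 2 <= k%:R ^+ 2 * pi_ n ^+ 2.
  rewrite exprMn ler_wpM2l ?sqr_ge0//.
  by apply: lerXn2r; rewrite ?nnegrE//; nra.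
have X0 : 0 <= k%:R ^+ 2 * pi_ n ^+ 2 * A + k%:R * pi_ n * tail_mean F A.
  by apply: addr_ge0; do 2![apply: mulr_ge0 => //]; exact: sqr_ge0.
set X := k%:R ^+ 2 * pi_ n ^+ 2 * A + k%:R * pi_ n * tail_mean F A in Qle X0.
rewrite (_ : k%:R ^+ 2 * _ + _ = X + k%:R ^+ 2 * pi_ n ^+ 2); last by rewrite /X; ring.
have Y0 : 0 <= k%:R ^+ 2 * pi_ n ^+ 2 by rewrite mulr_ge0 ?sqr_ge0.
have tE : t = 1 - s by rewrite /s; ring.
have sQge : s * (1 - k%:R * mu n) <= s * Q by rewrite ler_wpM2l.
have sQle : s * Q <= s * (1 - k%:R * mu n) + X.
  by rewrite (le_trans (ler_wpM2l s0 Qle))// mulrDr lerD2l ler_piMl.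
rewrite -/s ler_norml; apply/andP; split.
  by rewrite [in leRHS]tE; lra.
by rewrite [in leLHS]tE; lra.
Qed.

(** Averages the previous bound over K, with E[K] <= y and E[K^2] <= y + y^2 for y = w m pi. Setting
    z = n m pi^2, one has n pi^2 y = z w pi and n pi^2 y^2 = (z w)^2 / n, and z is at most beta
    gamma^2. *)
Lemma degree_pgf_sum_compare n A : 0 <= A ->
  `|degree_pgf_sum n - compound_pgf n| <=
  (A + 1) * (beta * gamma ^+ 2 * w * pi_ n +
             (beta * gamma ^+ 2 * w) ^+ 2 * n%:R^-1) +
  beta * gamma ^+ 2 * w * tail_mean F A.
Proof.
move=> A0.
have tl0 : 0 <= tail_mean F A by exact: tail_mean_ge0.
have C0 : 0 <= beta * gamma ^+ 2 * w by rewrite !mulr_ge0 ?sqr_ge0// ltW.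
(* For n = 0 the inner exponent is 0 and both quantities equal 1; the general case divides by n. *)
have [n0|n0] := posnP n.
  have -> : degree_pgf_sum n = 1.
    rewrite /degree_pgf_sum n0 -[RHS](sum_subset_weight (m 0) (r 0 w)).
    by apply: eq_bigr => S _; rewrite mulr1.
  rewrite /compound_pgf n0 expr0 subrr mulr0 subr0 expr1n subrr normr0.
  apply: addr_ge0; last exact: mulr_ge0.
  apply: mulr_ge0; first exact: addr_ge0.
  by apply: addr_ge0; apply: mulr_ge0; rewrite ?sqr_ge0 ?invr_ge0.
have /andP[rho0 rho1] := r01 n w.
have cmpE : compound_pgf n =
    \sum_(S : {set 'I_(m n)}) subset_weight (r n w) S *
      ((1 - s * mu n) ^+ n.-1) ^+ #|S|.
  by rewrite sum_subset_weight_expr /compound_pgf -/s; congr (_ ^+ _); ring.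
rewrite cmpE /degree_pgf_sum -sumrB (le_trans (ler_norm_sum _ _ _))//.
set B := pi_ n ^+ 2 * (A + 1); set D := pi_ n * tail_mean F A.
have B0 : 0 <= B by rewrite mulr_ge0 ?sqr_ge0 ?addr_ge0.
have D0 : 0 <= D by rewrite mulr_ge0.
rewrite (le_trans (y := \sum_(S : {set 'I_(m n)})
   n.-1%:R * (B * (subset_weight (r n w) S * #|S|%:R ^+ 2) +
              D * (subset_weight (r n w) S * #|S|%:R))))//.
  apply: ler_sum => S _; rewrite -mulrBr normrM ger0_norm ?subset_weight_ge0//.
  rewrite (le_trans (ler_wpM2l _ (summand_le _ _ A0))) ?subset_weight_ge0//.
  by rewrite -/B -/D le_eqVlt; apply/orP; left; apply/eqP; ring.
rewrite -mulr_sumr big_split/= -!mulr_sumr sum_subset_weight_card.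
have N_le : (n.-1%:R : R) <= n%:R by rewrite ler_nat leq_pred.
set x := (m n)%:R * r n w.
have x0 : 0 <= x by rewrite mulr_ge0.
have xle : x <= w * ((m n)%:R * pi_ n).
  by rewrite mulrCA ler_wpM2l.
have S2 := sum_subset_weight_card2 (m n) rho0; rewrite -/x in S2.
have nn0 : 0 < n%:R :> R by rewrite ltr0n.
apply: (@le_trans _ _ (n%:R * (B * (x + x ^+ 2) + D * x))).
  apply: ler_pM => //; last by rewrite lerD2r ler_wpM2l.
  apply: addr_ge0; last exact: mulr_ge0.
  apply: mulr_ge0 => //; apply: sumr_ge0 => S _.
  by apply: mulr_ge0; [exact: subset_weight_ge0|exact: sqr_ge0].
set y := w * ((m n)%:R * pi_ n) in xle.
have y0 : 0 <= y by exact: le_trans xle.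
apply: (@le_trans _ _ (n%:R * (B * (y + y ^+ 2) + D * y))).
  rewrite ler_wpM2l ?(ltW nn0)// lerD ?ler_wpM2l// lerD//.
  by apply: lerXn2r.
have := density_le alpha gamma beta0 n; rewrite -/m -/pi_.
set z := n%:R * _ * _ => zC.
have z0 : 0 <= z by apply: mulr_ge0; [exact: mulr_ge0|exact: sqr_ge0].
have zw : z * w <= beta * gamma ^+ 2 * w by rewrite ler_wpM2r// ltW.
have -> : n%:R * (B * (y + y ^+ 2) + D * y) =
    (A + 1) * (z * w * pi_ n + (z * w) ^+ 2 * n%:R^-1) + z * w * tail_mean F A.
  by rewrite /z /B /D /y; field; rewrite gt_eqF.
have zw0 : 0 <= z * w by rewrite mulr_ge0// ltW.
apply: lerD; last exact: ler_wpM2r.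
apply: ler_wpM2l; first exact: addr_ge0.
apply: lerD; first exact: ler_wpM2r.
by apply: ler_wpM2r; [rewrite invr_ge0|apply: lerXn2r].
Qed.

(** The tail term does not decrease with n: A is fixed first to bring it below e / 2, and then the
    remaining terms tend to 0. *)
Lemma cvg_degree_pgf_sum (L : R) :
  compound_pgf n @[n --> \oo] --> L -> degree_pgf_sum n @[n --> \oo] --> L.
Proof.
move=> cL; rewrite (_ : degree_pgf_sum =
    (fun n => (degree_pgf_sum n - compound_pgf n) + compound_pgf n)); last first.
  by apply/funext => n; rewrite subrK.
rewrite -[L]add0r; apply: cvgD => //; apply/cvgr0Pnorm_le => e e0.
set C := beta * gamma ^+ 2 * w.
have C0 : 0 < C by rewrite !mulr_gt0// exprn_gt0.
have [A A0 tA] : exists2 A, 0 < A & tail_mean F A <= e / 2 / C.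
  by apply: tail_mean_small => //; rewrite !divr_gt0.
have : (A + 1) * (C * pi_ n + C ^+ 2 * n%:R^-1) @[n --> \oo] --> (0 : R).
  rewrite -[X in _ --> X](mulr0 (A + 1)); apply: cvgMr.
  rewrite -[X in _ --> X]addr0; apply: cvgD.
    by rewrite -[X in _ --> X](mulr0 C); apply: cvgMr; exact: cvg_edge_scale.
  rewrite -[X in _ --> X](mulr0 (C ^+ 2)); apply: cvgMr.
  under eq_fun do rewrite -powR_inv1//.
  by apply: cvg_powRN.
move=> /cvgr_le/(_ (e / 2)); rewrite divr_gt0// => /(_ isT) h.
near=> n; rewrite (le_trans (degree_pgf_sum_compare n (ltW A0)))// -/C.
rewrite [leRHS](splitr e) lerD//; first by near: n; exact: h.
by rewrite mulrC -ler_pdivlMr.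
Unshelve. all: by end_near. Qed.

(** Together with mu <= pi this is mu ~ pi, stated without a quotient. *)
Let cvg_mean_ratio : forall e, 0 < e -> \forall n \near \oo,
  (1 - e) * pi_ n <= mu n.
Proof.
move=> e e0; have [A A0 tA] := tail_mean_small Fint e0.
have : A * pi_ n @[n --> \oo] --> (0 : R).
  by rewrite -[X in _ --> X](mulr0 A); apply: cvgMr; exact: cvg_edge_scale.
move=> /cvgr_le/(_ 1 ltr01) h; near=> n.
rewrite mulrC (le_trans _ (mean_edge_prob_ge gamma0 Fpos Fint Fmean _ (A := A)))//.
  by rewrite ler_wpM2l// lerD2l lerN2.
by near: n; exact: h.
Unshelve. all: by end_near. Qed.

Lemma cvg_scaled_mean (u : R^nat) (l : R) : (forall n, 0 <= u n) ->
  u n * pi_ n @[n --> \oo] --> l -> u n * mu n @[n --> \oo] --> l.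
Proof.
move=> u0 ul; rewrite -[l]subr0.
rewrite (_ : (fun n => u n * mu n) = (fun n => u n * pi_ n - u n * (pi_ n - mu n))); last first.
  by apply/funext => n; ring.
apply: cvgB => //; apply/cvgr0Pnorm_le => e e0.
have l0 : 0 <= l.
  apply: (cvgr_to_ge ul); near=> n; exact: mulr_ge0.
(* Eventually u pi <= l + 1; unlike l, this bound is positive and can serve as a divisor. *)
have l1 : 0 < l + 1 by rewrite ltr_wpDl.
have d0 : 0 < e / (l + 1) by rewrite divr_gt0.
have h := cvg_mean_ratio d0.
have /cvgr_le/(_ (l + 1)) := ul; rewrite ltrDl ltr01 => /(_ isT) hu.
near=> n; have muge : (1 - e / (l + 1)) * pi_ n <= mu n by near: n; exact: h.
have mule : mu n <= pi_ n by exact: mean_edge_prob_le.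
rewrite ger0_norm ?mulr_ge0 ?subr_ge0//.
rewrite (le_trans (y := u n * (e / (l + 1) * pi_ n)))//.
  by rewrite ler_wpM2l//; lra.
rewrite mulrCA -ler_pdivlMl// invf_div mulfVK ?gt_eqF//.
  by near: n; exact: hu.
Unshelve. all: by end_near. Qed.

Let cvg_mu : mu n @[n --> \oo] --> (0 : R).
Proof.
apply: (@squeeze_cvgr _ _ _ _ (fun=> 0) pi_).
- near=> n; have /andP[-> _] := mu01 n => /=; exact: mean_edge_prob_le.
- exact: cvg_cst.
- exact: cvg_edge_scale.
Unshelve. all: by end_near. Qed.

Let rwE : \forall n \near \oo, r n w = w * pi_ n.
Proof.
have : w * pi_ n @[n --> \oo] --> (0 : R).
  by rewrite -[X in _ --> X](mulr0 w); apply: cvgMr; exact: cvg_edge_scale.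
move=> /cvgr_le/(_ 1 ltr01) h; near=> n.
rewrite /r edge_prob_pos ?(ltW w0)//; apply/min_idPl.
by near: n; exact: h.
Unshelve. all: by end_near. Qed.

(** An instance of (1 - x_n)^(k_n) -> e^(-l) when x_n -> 0 and k_n x_n -> l; the weight w being
    fixed, truncation is eventually inactive and the edge probability may be replaced by w pi. *)
Lemma cvg_compound_pgf (l : R) :
  (m n)%:R * (w * pi_ n * (1 - (1 - s * mu n) ^+ n.-1)) @[n --> \oo] --> l ->
  compound_pgf n @[n --> \oo] --> expR (- l).
Proof.
move=> hl; have hx n : 0 <= 1 - (1 - s * mu n) ^+ n.-1 <= 1.
  have /andP[a0 a1] := smu01 n.
  have : 0 <= (1 - s * mu n) ^+ n.-1 <= 1.
    by rewrite exprn_ge0 ?subr_ge0//= exprn_ile1 ?subr_ge0//; lra.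
  by case/andP => ? ?; apply/andP; split; lra.
apply: cvg_expr_onem => [n||].
- have /andP[? ?] := r01 n w; have /andP[? ?] := hx n.
  by rewrite mulr_ge0//= mulr_ile1.
- apply: (@squeeze_cvgr _ _ _ _ (fun=> 0) (fun n => w * pi_ n)).
  + near=> n; have /andP[? ?] := r01 n w; have /andP[? ?] := hx n.
    rewrite mulr_ge0//= (le_trans _ (rw_le n))// ler_piMr//.
  + exact: cvg_cst.
  + by rewrite -[X in _ --> X](mulr0 w); apply: cvgMr; exact: cvg_edge_scale.
- apply: cvg_trans hl; apply: near_eq_cvg.
  by near=> n; rewrite -/s; congr (_ * (_ * _)); apply/esym; near: n; exact: rwE.
Unshelve. all: by end_near. Qed.

Lemma cvg_compound_pgf_critical : alpha = 1 ->
  compound_pgf n @[n --> \oo] -->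
  expR (beta * gamma * w * (expR (gamma * (t - 1)) - 1)).
Proof.
move=> alpha1; rewrite (_ : _ * (_ - 1) =
  - (beta * gamma * w * (1 - expR (- (s * gamma))))); last first.
  rewrite (_ : gamma * (t - 1) = - (s * gamma)); last by rewrite /s; ring.
  by ring.
apply: cvg_compound_pgf.
(* Since n pi = gamma exactly for n > 0, dividing the limit of n m pi^2 by gamma gives that of m
   pi. *)
have mpi : (m n)%:R * pi_ n @[n --> \oo] --> beta * gamma.
  have := @cvg_density _ alpha beta gamma alpha0 beta0; rewrite -/m -/pi_ => h.
  have : n%:R * (m n)%:R * pi_ n ^+ 2 / gamma @[n --> \oo] --> beta * gamma ^+ 2 / gamma.
    by apply: cvgM => //; exact: cvg_cst.
  rewrite (_ : beta * gamma ^+ 2 / gamma = beta * gamma); last by field; rewrite gt_eqF.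
  apply: cvg_trans; apply: near_eq_cvg; near=> n.
  have npi : (0 < n)%N -> n%:R * pi_ n = gamma by exact: edge_scale_critical.
  rewrite (_ : _ * _ * _ ^+ 2 = (m n)%:R * pi_ n * (n%:R * pi_ n)); last by ring.
  by rewrite npi ?mulfK ?gt_eqF//; near: n; exact: nbhs_infty_gt.
have Npi : n.-1%:R * pi_ n @[n --> \oo] --> gamma.
  have : gamma - pi_ n @[n --> \oo] --> gamma.
    rewrite -[X in _ --> X]subr0; apply: cvgB; first exact: cvg_cst.
    exact: cvg_edge_scale.
  apply: cvg_trans; apply: near_eq_cvg; near=> n.
  have n0 : (0 < n)%N by near: n; exact: nbhs_infty_gt.
  rewrite -(edge_scale_critical gamma alpha1 n0) -/pi_ -subn1 natrB//.
  by ring.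
have Nmu : n.-1%:R * (s * mu n) @[n --> \oo] --> s * gamma.
  under eq_fun do rewrite mulrCA.
  by apply: cvgMr; apply: cvg_scaled_mean.
have smu0 : s * mu n @[n --> \oo] --> (0 : R).
  by rewrite -[X in _ --> X](mulr0 s); exact: cvgMr.
have hexp := cvg_expr_onem smu01 smu0 Nmu.
rewrite (_ : (fun n => (m n)%:R * _) = (fun n => w * ((m n)%:R * pi_ n) *
    (1 - (1 - s * mu n) ^+ n.-1))); last by apply/funext => n; ring.
rewrite (mulrC _ w); apply: cvgM; first exact: cvgMr.
by apply: cvgB => //; exact: cvg_cst.
Unshelve. all: by end_near. Qed.

(** Here n pi -> 0, so two neighbours of i hardly ever come from the same group: 1 - (1 - s mu)^(n -
    1) is equivalent to (n - 1) s mu, and the compound law linearizes to a Poisson law. *)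
Lemma cvg_compound_pgf_dense : 1 < alpha ->
  compound_pgf n @[n --> \oo] --> expR (beta * gamma ^+ 2 * w * (t - 1)).
Proof.
move=> alpha1; rewrite (_ : _ * (t - 1) = - (w * s * (beta * gamma ^+ 2))); last first.
  by rewrite /s; ring.
apply: cvg_compound_pgf.
have Npi : n.-1%:R * pi_ n @[n --> \oo] --> (0 : R).
  apply: (@squeeze_cvgr _ _ _ _ (fun=> 0) (fun n => n%:R * pi_ n)).
  - by near=> n; rewrite mulr_ge0//= ler_wpM2r// ler_nat leq_pred.
  - exact: cvg_cst.
  - exact: cvg_edge_scale_dense.
have mNpi : (m n)%:R * pi_ n * n.-1%:R * pi_ n @[n --> \oo] --> beta * gamma ^+ 2.
  have := @cvg_density _ alpha beta gamma alpha0 beta0; rewrite -/m -/pi_ => h.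
  rewrite -[X in _ --> X]subr0.
  (* Correction for n - 1 in place of n: m pi^2 is the convergent n m pi^2 divided by n. *)
  have h2 : (m n)%:R * pi_ n ^+ 2 @[n --> \oo] --> (0 : R).
    have : n%:R `^ (- 1) * (n%:R * (m n)%:R * pi_ n ^+ 2) @[n --> \oo] --> (0 : R).
      rewrite -[X in _ --> X](mul0r (beta * gamma ^+ 2)); apply: cvgM => //.
      exact: cvg_powRN.
    apply: cvg_trans; apply: near_eq_cvg; near=> n.
    have n0 : (0 < n)%N by near: n; exact: nbhs_infty_gt.
    rewrite powR_inv1// -mulrA mulKf// pnatr_eq0 -lt0n//.
  apply: cvg_trans (cvgB h h2); apply: near_eq_cvg; near=> n.
  have n0 : (0 < n)%N by near: n; exact: nbhs_infty_gt.
  rewrite -subn1 natrB// ?fctE/=; ring.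
have mNmu : w * s * ((m n)%:R * pi_ n * n.-1%:R * mu n) @[n --> \oo] -->
    w * s * (beta * gamma ^+ 2).
  apply: cvgMr; apply: (cvg_scaled_mean (u := fun n => (m n)%:R * pi_ n * n.-1%:R)) => // n.
  by do 2![apply: mulr_ge0 => //].
have Nsmu : n.-1%:R * (s * mu n) @[n --> \oo] --> (0 : R).
  rewrite -[X in _ --> X](mulr0 s); under eq_fun do rewrite mulrCA.
  by apply: cvgMr; apply: cvg_scaled_mean.
(* With y = (n - 1) s mu -> 0, the first- and second-order bounds on the power give y (1 - y) <= 1 -
   (1 - s mu)^(n - 1) <= y. *)
apply: (squeeze_cvgr (f := fun n => w * s * ((m n)%:R * pi_ n * n.-1%:R * mu n) *
   (1 - n.-1%:R * (s * mu n))) _ _ mNmu); last first.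
  rewrite -[X in _ --> X]mulr1; apply: cvgM => //.
  by rewrite -[X in _ --> X]subr0; apply: cvgB => //; exact: cvg_cst.
near=> n; have lo := expr_onem_ge n.-1 (smu01 n).
have hi := expr_onem_le n.-1 (smu01 n).
have mwp : 0 <= (m n)%:R * (w * pi_ n) by rewrite !mulr_ge0// ltW.
set y := n.-1%:R * (s * mu n) in lo hi *.
set X := (1 - s * mu n) ^+ n.-1 in lo hi *.
rewrite (_ : w * s * ((m n)%:R * pi_ n * n.-1%:R * mu n) =
  (m n)%:R * (w * pi_ n) * y); last by rewrite /y; ring.
rewrite [(m n)%:R * (w * pi_ n * (1 - X))]mulrA -mulrA.
by apply/andP; split; apply: ler_wpM2l => //; lra.
Unshelve. all: by end_near. Qed.

End pgf_limit.

(** * Continuity theorem for generating functions *)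

Section averaging_functionals.
Context {R : realType}.
Implicit Types (f g : nat -> R) (L : (nat -> R) -> R).

Definition bounded_seq f := exists M : R, forall k, `|f k| <= M.

(** Abstracts f -> E[f(X)], so that expectations over the varying spaces and under the limit law are
    treated alike. *)
Definition averaging L := [/\
  forall f g, bounded_seq f -> bounded_seq g ->
    L (fun k => f k + g k) = L f + L g,
  forall c f, bounded_seq f -> L (fun k => c * f k) = c * L f,
  forall f g, bounded_seq f -> bounded_seq g ->
    (forall k, f k <= g k) -> L f <= L g &
  L (fun=> 1) = 1].

Definition atom (j k : nat) : R := (k == j)%:R.

Lemma bounded_seqD f g :
  bounded_seq f -> bounded_seq g -> bounded_seq (fun k => f k + g k).
Proof.
move=> [M fM] [N gN]; exists (M + N) => k.
by rewrite (le_trans (ler_normD _ _))// lerD.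
Qed.

Lemma bounded_seqZ c f : bounded_seq f -> bounded_seq (fun k => c * f k).
Proof.
by move=> [M fM]; exists (`|c| * M) => k; rewrite normrM ler_wpM2l.
Qed.

Lemma bounded_seq_cst c : bounded_seq (fun=> c).
Proof. by exists `|c|. Qed.

Lemma bounded_atom j : bounded_seq (atom j).
Proof. by exists 1 => k; rewrite /atom; case: eqP; rewrite ?normr1 ?normr0. Qed.

Lemma bounded_seq_sum (J : nat) (c : nat -> R) :
  bounded_seq (fun k => \sum_(l < J) c l * atom l k).
Proof.
elim: J => [|J IH].
  by under eq_fun do rewrite big_ord0; exact: bounded_seq_cst.
under eq_fun do rewrite big_ord_recr/=.
by apply: bounded_seqD => //; apply: bounded_seqZ; exact: bounded_atom.
Qed.

Lemma sum_atomE (J : nat) (c : nat -> R) k :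
  \sum_(l < J) c l * atom l k = if (k < J)%N then c k else 0.
Proof.
case: ltnP => kJ.
  rewrite (bigD1 (Ordinal kJ))//= /atom eqxx mulr1 big1 ?addr0// => l.
  by rewrite -val_eqE/= eq_sym => /negbTE ->; rewrite mulr0.
rewrite big1// => l _; rewrite /atom gtn_eqF ?mulr0//.
exact: leq_trans (ltn_ord l) kJ.
Qed.

Lemma averaging_dist L f g (e : R) : averaging L -> bounded_seq f -> bounded_seq g ->
  (forall k, `|f k - g k| <= e) -> `|L f - L g| <= e.
Proof.
move=> [LD LZ Lle L1] bf bg fg.
have Lc : L (fun=> e) = e.
  rewrite (_ : (fun=> e) = (fun k : nat => e * 1)); last first.
    by apply/funext => k; rewrite mulr1.
  by rewrite LZ ?L1 ?mulr1//; exact: bounded_seq_cst.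
have be := bounded_seq_cst e.
rewrite ler_distl lerBlDr -{1 2}Lc -!LD//.
apply/andP; split; apply: Lle => //; try exact: bounded_seqD.
- by move=> k; have := fg k; rewrite ler_distl lerBlDr => /andP[].
- by move=> k; have := fg k; rewrite ler_distl lerBlDr => /andP[].
Qed.

(** Cutting f to the integers below J costs at most M times the mass of the others. *)
Lemma averaging_dist_mul L f (J : nat) (M : R) : averaging L ->
  (forall k, `|f k| <= M) ->
  `|L f - L (fun k => \sum_(l < J) f l * atom l k)| <=
  M * (1 - L (fun k => \sum_(l < J) 1 * atom l k)).
Proof.
move=> [LD LZ Lle L1] fM.
have bf : bounded_seq f by exists M.
pose h (c : nat -> R) (k : nat) : R := \sum_(l < J) c l * atom l k.
have bh c : bounded_seq (h c) := bounded_seq_sum J c.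
have b1 := bounded_seq_cst 1.
have LB u v : bounded_seq u -> bounded_seq v ->
    L (fun k => u k - v k) = L u - L v.
  move=> bu bv; rewrite -[in RHS]mulN1r -LZ// -LD//; last exact: bounded_seqZ.
  by congr L; apply/funext => k; rewrite mulN1r.
have bB u v : bounded_seq u -> bounded_seq v -> bounded_seq (fun k => u k - v k).
  move=> bu bv; rewrite (_ : (fun k => _) = (fun k => u k + (-1) * v k)); last first.
    by apply/funext => k; rewrite mulN1r.
  by apply: bounded_seqD => //; exact: bounded_seqZ.
have key N : (forall k, `|f k| <= N) -> forall k,
    `|f k - h f k| <= N * (1 - h (fun=> 1) k).
  move=> fN k; rewrite /h (sum_atomE J f) (sum_atomE J (fun=> 1)); case: ifP => _.
    by rewrite !subrr normr0 mulr0.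
  by rewrite !subr0 mulr1.
have bB1 : bounded_seq (fun k => 1 - h (fun=> 1) k) by exact: bB.
have bg : bounded_seq (fun k => M * (1 - h (fun=> 1) k)) by exact: bounded_seqZ.
have bfh : bounded_seq (fun k => f k - h f k) by exact: bB.
have <- : L (fun k => f k - h f k) = L f - L (h f) by exact: LB.
have <- : L (fun k => M * (1 - h (fun=> 1) k)) = M * (1 - L (h (fun=> 1))).
  by rewrite (LZ M _ bB1) (LB (fun=> 1) (h (fun=> 1)))// L1.
have NE : L (fun k => (-1) * (M * (1 - h (fun=> 1) k))) =
    - L (fun k => M * (1 - h (fun=> 1) k)) by rewrite (LZ (-1) _ bg) mulN1r.
rewrite ler_norml -NE; apply/andP; split.
  apply: Lle => //; first exact: bounded_seqZ.
  by move=> k; have := key M fM k; rewrite ler_norml mulN1r => /andP[].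
apply: Lle => // k.
by have := key M fM k; rewrite ler_norml => /andP[].
Qed.

Section pgf_continuity.
Variables (L_ : nat -> (nat -> R) -> R) (L : (nat -> R) -> R).
Hypotheses (L_avg : forall n, averaging (L_ n)) (L_avg' : averaging L).

(** The class of test sequences along which convergence holds. It is closed under linear
    combinations and uniform limits, which suffices to reach all indicators of integers from the
    generating functions. *)
Let good f := bounded_seq f /\ L_ n f @[n --> \oo] --> L f.

Let goodD f g : good f -> good g -> good (fun k => f k + g k).
Proof.
move=> [bf cf] [bg cg]; split; first exact: bounded_seqD.
have [-> // _ _ _] := L_avg'.
rewrite (_ : (fun n => _) = (fun n => L_ n f + L_ n g)); first exact: cvgD.
by apply/funext => n; have [-> //] := L_avg n.
Qed.

Let goodZ c f : good f -> good (fun k => c * f k).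
Proof.
move=> [bf cf]; split; first exact: bounded_seqZ.
have [_ -> // _ _] := L_avg'.
rewrite (_ : (fun n => _) = (fun n => c * L_ n f)); first exact: cvgMr.
by apply/funext => n; have [_ -> //] := L_avg n.
Qed.

Let good_uniform_limit f : bounded_seq f ->
  (forall e, 0 < e -> exists2 g, good g & forall k, `|f k - g k| <= e) -> good f.
Proof.
move=> bf fg; split => //; apply/cvgrPdist_le => e e0.
have e3 : 0 < e / 3 by rewrite divr_gt0.
have [g [bg cg] gf] := fg _ e3.
move/cvgrPdist_le: cg => /(_ _ e3) cg; near=> n.
have h1 := averaging_dist L_avg' bf bg gf.
have h2 := averaging_dist (L_avg n) bf bg gf.
have h3 : `|L g - L_ n g| <= e / 3 by near: n; exact: cg.
rewrite (_ : L f - L_ n f = (L f - L g) + (L g - L_ n g) - (L_ n f - L_ n g)); last by ring.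
rewrite (le_trans (ler_normB _ _))// (_ : e = e / 3 + e / 3 + e / 3); last by field.
by rewrite lerD// (le_trans (ler_normD _ _))// lerD.
Unshelve. all: by end_near. Qed.

Hypothesis pgf_cvg : forall t : R, 0 <= t <= 1 ->
  L_ n (fun k => t ^+ k) @[n --> \oo] --> L (fun k => t ^+ k).

Let good_pgf t : 0 <= t <= 1 -> good (fun k => t ^+ k).
Proof.
move=> t01; split; last exact: pgf_cvg.
have /andP[t0 t1] := t01.
by exists 1 => k; rewrite ger0_norm ?exprn_ge0// exprn_ile1.
Qed.

Let good_sum (J : nat) (c : nat -> R) :
  (forall l, (l < J)%N -> good (atom l)) ->
  good (fun k => \sum_(l < J) c l * atom l k).
Proof.
elim: J => [_|J IH gJ].
  under eq_fun do rewrite big_ord0.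
  have := goodZ 0 (good_pgf (introT andP (conj (lexx 0) ler01))).
  rewrite (_ : (fun k => 0 * _) = (fun=> 0))//.
  by apply/funext => k; rewrite mul0r.
under eq_fun do rewrite big_ord_recr/=.
apply: goodD; last by apply: goodZ; exact: gJ.
by apply: IH => l lJ; apply: gJ; exact: ltnW.
Qed.

(* [t^-j (t^k - \sum_(l < j) t^l atom l k)] is [0] for [k < j], [1] for
   [k = j] and [t^(k - j)] for [k > j]. *)
Let good_atom j : good (atom j).
Proof.
elim/ltn_ind: j => j IH; apply: good_uniform_limit => [|e e0].
  exact: bounded_atom.
pose t := Num.min e 1.
have t0 : 0 < t by rewrite lt_min e0 ltr01.
have t1 : t <= 1 by rewrite ge_min lexx orbT.
have te : t <= e by rewrite ge_min lexx.
exists (fun k => (t ^+ j)^-1 * (t ^+ k + (-1) * \sum_(l < j) t ^+ l * atom l k)).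
  apply: goodZ; apply: goodD; first by apply: good_pgf; rewrite (ltW t0).
  by apply: goodZ; exact: good_sum.
move=> k; rewrite sum_atomE mulN1r /atom; case: ltngtP => [kj|kj|->].
- by rewrite subrr mulr0 subrr normr0 ltW.
- rewrite subr0 sub0r normrN mulrC -expfB// ger0_norm ?exprn_ge0 ?(ltW t0)//.
  rewrite (le_trans _ te)// -[leRHS]expr1 ler_wiXn2l// ?(ltW t0)//.
  by rewrite subn_gt0.
- by rewrite subr0 mulVf ?subrr ?normr0 ?(ltW e0)// expf_neq0// gt_eqF.
Qed.

Hypothesis tight : forall e : R, 0 < e ->
  exists J : nat, 1 - e <= L (fun k => \sum_(l < J) 1 * atom l k).

(** Tightness is assumed of the limit alone; convergence of the mass below J transfers it to [L_ n].
    Of the four quarters of e, one bounds the cut for [L], one the convergence of the cut sequence,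
    and two the cut for [L_ n]. *)
Lemma cvg_averaging f : bounded_seq f -> L_ n f @[n --> \oo] --> L f.
Proof.
(* Adding 1 keeps M positive, as e / (4 M) requires. *)
move=> [M0 fM0]; pose M := M0 + 1.
have M00 : 0 <= M0 by exact: le_trans (fM0 0%N).
have M_gt0 : 0 < M by rewrite ltr_wpDl.
have fM k : `|f k| <= M by rewrite (le_trans (fM0 k))// lerDl.
apply/cvgrPdist_le => e e0.
have d0 : 0 < e / (4 * M) by rewrite divr_gt0// mulr_gt0.
have [J LJ] := tight d0.
have [_ c1] := good_sum (fun=> 1) (fun l _ => good_atom l) (J := J).
have [_ cf] := good_sum f (fun l _ => good_atom l) (J := J).
have e4 : 0 < e / 4 by rewrite divr_gt0.
move/cvgrPdist_le: c1 => /(_ _ d0) c1; move/cvgrPdist_le: cf => /(_ _ e4) cf.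
near=> n.
have h1 := averaging_dist_mul J L_avg' fM.
have h2 := averaging_dist_mul J (L_avg n) fM.
set hf := fun k => \sum_(l < J) f l * atom l k in h1 h2 *.
set h := fun k => \sum_(l < J) 1 * atom l k in h1 h2 LJ *.
have h3 : `|L hf - L_ n hf| <= e / 4 by near: n; exact: cf.
have h4 : `|L h - L_ n h| <= e / (4 * M) by near: n; exact: c1.
have h5 : M * (1 - L h) <= e / 4.
  rewrite mulrC -ler_pdivlMr// (_ : e / 4 / M = e / (4 * M)); first by lra.
  by field; rewrite gt_eqF.
have h6 : M * (1 - L_ n h) <= e / 4 + e / 4.
  rewrite mulrC -ler_pdivlMr// (_ : (_ + _) / M = e / (4 * M) + e / (4 * M)); last first.
    by field; rewrite gt_eqF.
  by have := le_trans (ler_norm _) h4; lra.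
rewrite (_ : L f - L_ n f = (L f - L hf) + (L hf - L_ n hf) - (L_ n f - L_ n hf)); last by ring.
rewrite (le_trans (ler_normB _ _))// (_ : e = e / 4 + e / 4 + (e / 4 + e / 4)); last by field.
rewrite lerD ?(le_trans h2)// (le_trans (ler_normD _ _))// lerD//.
exact: le_trans h1 h5.
Unshelve. all: by end_near. Qed.

End pgf_continuity.

(** * Expectations as averaging functionals, and the Poisson generating function *)

Lemma bounded_comp_integrable d (T : measurableType d) (P : probability T R)
    (X : T -> nat) f : measurable_fun setT X -> bounded_seq f ->
  P.-integrable setT (EFin \o (f \o X)).
Proof.
move=> mX [M fM]; apply: measurable_bounded_integrable => //.
- by rewrite ltey_eq fin_num_measure.
- by apply: measurableT_comp.
- exists M; split; first exact: num_real.
  by move=> N MN x _ /=; rewrite (le_trans (fM _))// ltW.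
Qed.

Lemma averaging_Rintegral d (T : measurableType d) (P : probability T R)
    (X : T -> nat) : measurable_fun setT X ->
  averaging (fun f => \int[P]_x f (X x)).
Proof.
move=> mX; have bI := bounded_comp_integrable P mX.
split.
- move=> f g bf bg; exact: (RintegralD measurableT (bI _ bf) (bI _ bg)).
- by move=> c f bf; rewrite RintegralZl//; exact: bI.
- move=> f g bf bg fg.
  by apply: (le_Rintegral measurableT (bI _ bf) (bI _ bg)) => x _; exact: fg.
- exact: Rintegral_cst_probability.
Qed.

Lemma probability_nat_tight (mu : probability nat R) e : 0 < e ->
  exists J : nat, 1 - e <= \int[mu]_k \sum_(l < J) 1 * atom l k.
Proof.
move=> e0.
have : (\int[mu]_k (\sum_(l < J) 1 * atom l k)%:E)%E @[J --> \oo] -->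
    (\int[mu]_k (cst 1%E k))%E.
  apply: (@dominated_cvg _ _ _ mu _ measurableT _ _ (cst 1%E)) => //.
  - move=> k _; apply: cvg_near_cst; near=> J.
    by rewrite (sum_atomE J (fun=> 1)) ifT//; near: J; exact: nbhs_infty_gt.
  - exact: finite_measure_integrable_cst.
  - move=> J k _; rewrite /= lee_fin (sum_atomE J (fun=> 1)); case: ifP => _; rewrite ?normr1 ?normr0//.
rewrite integral_cst// mul1e [X in _ --> X]probability_setT => /fine_cvgP[_].
move=> /cvgr_ge/(_ (1 - e)); rewrite gtrBl e0 => /(_ isT)[J _ hJ].
by exists J; exact: (hJ J (leqnn J)).
Unshelve. all: by end_near. Qed.

Lemma cvg_dist_nat_pgf d (T : nat -> measurableType d)
    (P : forall n, probability (T n) R) (D : forall n, T n -> nat)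
    (mu : probability nat R) :
  (forall n, measurable_fun setT (D n)) ->
  (forall t : R, 0 <= t <= 1 ->
    \int[P n]_x (t ^+ D n x) @[n --> \oo] --> \int[mu]_k (t ^+ k)) ->
  cvg_dist_nat P D mu.
Proof.
move=> mD pgf f bf.
have mid : measurable_fun setT (id : nat -> nat) by [].
have := @cvg_averaging (fun n f => \int[P n]_x f (D n x)) (fun f => \int[mu]_k f k)
  (fun n => averaging_Rintegral (P n) (mD n)) (averaging_Rintegral mu mid)
  pgf (probability_nat_tight mu) f bf.
move=> h; rewrite [X in _ --> X](_ : _ = (\int[mu]_k f k)%:E); last first.
  rewrite /Rintegral fineK//; apply: integrable_fin_num => //.
  exact: (bounded_comp_integrable mu mid bf).
apply: cvg_EFin; last exact: h.
near=> n; apply: integrable_fin_num => //.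
exact: (bounded_comp_integrable (P n) (mD n) bf).
Unshelve. all: by end_near. Qed.

(** Writing t^k as a series of indicators of integers reduces the integral to the masses of atoms,
    and the sum to the exponential series at rate t. *)
Lemma poisson_pgf (rate t : R) : 0 < rate -> 0 <= t ->
  (\int[poisson_prob rate 0]_k (t ^+ k)%:E = (expR (rate * (t - 1)))%:E)%E.
Proof.
move=> rate0 t0.
have poisson_atom j : poisson_prob rate 0 [set j] = (poisson_pmf rate j)%:E.
  by rewrite /poisson_prob rate0 esum_set1// lee_fin poisson_pmf_ge0.
transitivity (\int[poisson_prob rate 0]_k
    (\sum_(j <oo) (t ^+ j)%:E * (\1_[set j] k)%:E))%E.
  apply: eq_integral => k _; apply/esym.
  rewrite (@nneseriesD1 _ _ k xpredT)//=; last first.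
    by move=> *; rewrite mule_ge0// lee_fin exprn_ge0.
  rewrite indicE mem_set// mule1 eseries0 ?adde0// => j _ jk.
  by rewrite indicE memNset ?mule0//= => kj; rewrite kj eqxx in jk.
rewrite integral_nneseries//; last first.
  by move=> j k _; rewrite mule_ge0// lee_fin exprn_ge0.
rewrite (eq_eseriesr (g := fun j => ((expR (- rate))%:E *
    ((rate * t) ^+ j / j`!%:R)%:E)%E)); last first.
  move=> j _; rewrite ge0_integralZl//; last by rewrite lee_fin exprn_ge0.
  rewrite integral_indic// setIT [X in (_ * X)%E](poisson_atom j).
  by rewrite -!EFinM /poisson_pmf rate0 exprMn; congr EFin; ring.
rewrite nneseriesZl/=; last first.
  by move=> j _; rewrite lee_fin divr_ge0// exprn_ge0// mulr_ge0// ltW.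
rewrite (_ : rate * (t - 1) = - rate + rate * t); last by ring.
rewrite expRD EFinM; congr (_ * _)%E.
rewrite expRE -EFin_lim; last first.
  rewrite /pseries/=; under eq_fun do rewrite mulrC.
  exact: is_cvg_series_exp_coeff.
apply/congr_lim/funext => j/=; rewrite /pseries/= /series/= -sumEFin//.
by under eq_bigr do rewrite mulrC.
Qed.

End averaging_functionals.

(** * Limits of the degree *)

Section degree_limits.
Context {R : realType} (alpha beta gamma : R) (F : probability R R) (i : nat).
Hypotheses (alpha0 : 0 < alpha) (beta0 : 0 < beta) (gamma0 : 0 < gamma).
Hypothesis Fpos : F [set x : R | 0 < x] = 1%E.
Hypothesis Fint : F.-integrable [set: R] (fun x => x%:E).
Hypothesis Fmean : (\int[F]_x x%:E = 1)%E.
Context {d : measure_display} (T : nat -> measurableType d).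
Variables (P : forall n, probability (T n) R) (W : forall n, nat -> T n -> R)
  (U : forall n, nat -> nat -> T n -> R).

Local Notation D n := (degree alpha beta gamma n i (@W n) (@U n)).

Lemma cvg_degree_sparse : alpha < 1 ->
  (forall n, GnmF_model alpha beta gamma F n i None (P n) (@W n) (@U n)) ->
  cvg_dist_nat P (fun n => D n) (@dirac _ nat 0%N R).
Proof.
move=> alpha1 model f [M fM].
rewrite integral_dirac// diracT mul1e.
(* Vertex i exists only once n > i, so every estimate on its degree is an eventual one. *)
have dev n : (i < n)%N -> exists2 y, (\int[P n]_x (f (D n x))%:E)%E = y%:E &
    `|y - f 0%N| <= 2 * M * ((ngroups alpha beta n)%:R * edge_scale alpha gamma n).
  move=> lein; have [y yE yf] := degree_deviation (i := Ordinal lein) fM (model n).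
  exists y => //; apply: (le_trans yf).
  have M0 : 0 <= M by exact: le_trans (fM 0%N).
  by rewrite ler_wpM2l ?mulr_ge0// ler_wpM2l//; exact: mean_edge_prob_le.
apply: cvg_EFin.
  by near=> n; have [|y -> _] := dev n; first by near: n; exact: nbhs_infty_gt.
apply/subr_cvg0.
have bound0 : 2 * M * ((ngroups alpha beta n)%:R * edge_scale alpha gamma n)
    @[n --> \oo] --> (0 : R).
  by rewrite -[X in _ --> X](mulr0 (2 * M)); apply: cvgMr; exact: cvg_edge_scale_sparse.
apply/cvgr0Pnorm_le => e e0; move/cvgr_le: bound0 => /(_ e e0) bound0.
near=> n; have [|y yE yf] := dev n; first by near: n; exact: nbhs_infty_gt.
by rewrite /= yE /= (le_trans yf)//; near: n; exact: bound0.
Unshelve. all: by end_near. Qed.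

Section conditioned.
Variable w : R.
Hypothesis w0 : 0 < w.
Hypothesis model : forall n,
  GnmF_model alpha beta gamma F n i (Some w) (P n) (@W n) (@U n).

Lemma cvg_degree_pgf (t L : R) : 0 <= t <= 1 ->
  compound_pgf alpha beta gamma F w t n @[n --> \oo] --> L ->
  (\int[P n]_x (t ^+ D n x)%:E)%E @[n --> \oo] --> L%:E.
Proof.
move=> t01 cL.
have pgfE n : (i < n)%N -> (\int[P n]_x (t ^+ D n x)%:E)%E =
    (degree_pgf_sum alpha beta gamma F w t n)%:E.
  by move=> lein; exact: (degree_pgf (i := Ordinal lein) t (model n)).
apply: cvg_EFin.
  by near=> n; rewrite pgfE//; near: n; exact: nbhs_infty_gt.
have cS := cvg_degree_pgf_sum alpha0 beta0 gamma0 Fpos Fint Fmean w0 t01 cL.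
apply: cvg_trans cS; apply: near_eq_cvg; near=> n.
by rewrite /= pgfE//; near: n; exact: nbhs_infty_gt.
Unshelve. all: by end_near. Qed.

Lemma cvg_degree_dense : 1 < alpha ->
  cvg_dist_nat P (fun n => D n) (poisson_prob (beta * gamma ^+ 2 * w) 0%N).
Proof.
move=> alpha1 f bf.
have rate0 : 0 < beta * gamma ^+ 2 * w by rewrite !mulr_gt0// exprn_gt0.
(* The continuity theorem asks for measurability of every term, while the description by
   configurations covers n > i; dropping the first i + 1 terms leaves the limit unchanged. *)
rewrite -(cvg_shiftn i.+1).
apply: (cvg_dist_nat_pgf (P := fun n => P (n + i.+1)) (D := fun n => D (n + i.+1))) bf.
  move=> n; have lein : (i < n + i.+1)%N by rewrite leq_addl.
  exact: (measurable_degree (i := Ordinal lein) (model (n + i.+1))).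
move=> t t01; have /andP[t0 _] := t01.
rewrite [X in _ --> X]/Rintegral poisson_pgf//=.
rewrite (cvg_shiftn i.+1 (fun n => \int[P n]_x (t ^+ D n x))).
have := cvg_compound_pgf_dense alpha0 beta0 gamma0 Fpos Fint Fmean w0 t01 alpha1.
by move=> /(cvg_degree_pgf t01)/fine_cvgP[].
Qed.

End conditioned.

End degree_limits.

Unset Implicit Arguments.
Set Strict Implicit.
Set Printing Implicit Defensive.

Theorem theorem1p2 (R : realType) (alpha beta gamma : R) (F : probability R R)
    (i : nat) :
  0 < alpha -> 0 < beta -> 0 < gamma ->
  (* F is a law on (0, oo) with finite mean 1 *)
  F [set x : R | 0 < x] = 1%E ->
  F.-integrable [set: R] (fun x => x%:E) ->
  (\int[F]_x x%:E = 1)%E ->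
  [/\
   (* (a) alpha < 1: D_i converges in distribution to the point mass at 0 *)
   alpha < 1 ->
     forall (d : measure_display) (T : nat -> measurableType d)
       (P : forall n, probability (T n) R)
       (W : forall n, nat -> T n -> R) (U : forall n, nat -> nat -> T n -> R),
     (forall n, GnmF_model alpha beta gamma F n i None (P n) (W n) (U n)) ->
     cvg_dist_nat P (fun n => degree alpha beta gamma n i (W n) (U n))
       (@dirac _ nat 0%N R),
   (* (b) alpha = 1: given W_i = w, E[t^D_i] -> exp(beta gamma w (e^{gamma(t-1)} - 1)) *)
   alpha = 1 ->
     forall w : R, 0 < w ->
     forall (d : measure_display) (T : nat -> measurableType d)
       (P : forall n, probability (T n) R)
       (W : forall n, nat -> T n -> R) (U : forall n, nat -> nat -> T n -> R),
     (forall n, GnmF_model alpha beta gamma F n i (Some w) (P n) (W n) (U n)) ->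
     forall t : R, 0 <= t <= 1 ->
       (fun n => (\int[P n]_x
           (t ^+ degree alpha beta gamma n i (W n) (U n) x)%:E)%E)
         @ \oo --> (expR (beta * gamma * w * (expR (gamma * (t - 1)) - 1)))%:E
   &
   (* (c) alpha > 1: given W_i = w, D_i converges in distribution to
      Poisson(beta gamma^2 w) *)
   1 < alpha ->
     forall w : R, 0 < w ->
     forall (d : measure_display) (T : nat -> measurableType d)
       (P : forall n, probability (T n) R)
       (W : forall n, nat -> T n -> R) (U : forall n, nat -> nat -> T n -> R),
     (forall n, GnmF_model alpha beta gamma F n i (Some w) (P n) (W n) (U n)) ->
     cvg_dist_nat P (fun n => degree alpha beta gamma n i (W n) (U n))
       (poisson_prob (beta * gamma ^+ 2 * w) 0%N)].
Proof.
move=> alpha0 beta0 gamma0 Fpos Fint Fmean; split.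
- move=> alpha1 d T P W U model.
  exact: (cvg_degree_sparse beta0 gamma0 Fpos Fint Fmean alpha1 model).
- move=> alpha1 w w0 d T P W U model t t01.
  apply: (cvg_degree_pgf alpha0 beta0 gamma0 Fpos Fint Fmean w0 model t01).
  exact: cvg_compound_pgf_critical.
- move=> alpha1 w w0 d T P W U model.
  exact: (cvg_degree_dense alpha0 beta0 gamma0 Fpos Fint Fmean w0 model alpha1).
Qed.
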